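(* Let $0 < r < p < 2$ with $r \le 1$, and let $q$ be defined by $\frac1p+\frac1q=\frac1r$. There exist positive constants $c_{p,r}, c(p,r), C(p,r), b_{p,r}$ depending only on $p$ and $r$ such that the following holds. Let $\eta \in (0,1]$ (with $\eta n$ a positive integer) and $\delta = c_{p,r}\, \eta / \log(1+1/\eta)$. Then with probability greater than $1 - 2 \exp(-b_{p,r} \eta n)$, the operator $S / (\eta n)^{1/q}:\ell_p^n\to\ell_r^{\eta n}$ satisfies property $\mathcal{P}_1(\delta n)$. More precisely, $$ \forall x \in \mathrm{sparse}(\delta n) \quad c(p,r) |x|_p \le \frac{1}{(\eta n)^{1/q}} |Sx|_r \le C(p,r) |x|_p . $$
   Context: For $s>0$, $|x|_s=(\sum_i|x_i|^s)^{1/s}$ and $\ell_s^N=(\mathbb{R}^N,|\cdot|_s)$. For real $t>0$, $\mathrm{sparse}(t)=\{x\in\mathbb{R}^n:|\mathrm{supp}(x)|\le t\}$. Property $\mathcal{P}_1(t)$ for an operator $A:\ell_p^n\to E$ into a quasi-normed space $E$ (with constants $\alpha,\beta>0$): for all $x\in\mathrm{sparse}(t)$, $\alpha|x|_p\le\|Ax\|_E\le\beta|x|_p$. The random operator $S$: let $Y$ be the random vector in $\mathbb{R}^{\eta n}$ taking each of the values $\pm e_1,\dots,\pm e_{\eta n}$ (the signed vectors of the canonical basis of $\mathbb{R}^{\eta n}$) with probability $\frac{1}{2\eta n}$. Let $(Y_{ij})$, $1\le i\le n$, $j\ge1$, be independent copies of $Y$. Then $$S:\ell_p^n\to\ell_r^{\eta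 n},\qquad x=(x_1,\dots,x_n)\mapsto\sum_{i=1}^n x_i\sum_{j\ge1}\frac{1}{j^{1/p}}Y_{ij}.$$ *)

(* Defs.v *)
From HB Require Import structures.
From mathcomp Require Import all_boot all_order all_algebra finmap.
From mathcomp Require Import all_classical all_reals all_analysis.

Set Implicit Arguments.
Unset Strict Implicit.
Unset Printing Implicit Defensive.

Import Order.TTheory GRing.Theory Num.Theory.
Import numFieldNormedType.Exports.

Local Open Scope classical_set_scope.
Local Open Scope ring_scope.

Section Vectors.
Context {R : realType}.

(* Meant for [0 < s]; only a quasi-norm when [s < 1]. *)
Definition lnorm (s : R) (N : nat) (x : 'rV[R]_N) : R :=
  (\sum_(i < N) `|x ord0 i| `^ s) `^ s^-1.

Definition supp (N : nat) (x : 'rV[R]_N) : {set 'I_N} :=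
  [set i | x ord0 i != 0]%SET.

Definition sparse (N : nat) (t : R) : set 'rV[R]_N :=
  [set x | #|supp x|%:R <= t].

(* [normE] is the quasi-norm of the target space [E]. *)
Definition property_P1 (p : R) (N : nat) (E : lmodType R) (normE : E -> R)
    (A : 'rV[R]_N -> E) (t alpha beta : R) : Prop :=
  forall x, sparse t x ->
    alpha * lnorm p x <= normE (A x) <= beta * lnorm p x.

End Vectors.

Arguments lnorm {R} s {N} x.

Section RandomVectors.
Context {d : measure_display} {Omega : measurableType d} {R : realType}.
Variable P : probability Omega R.

Definition borel_set (T : topologicalType) : set (set T) := <<s @open T >>.

Definition random_element (T : topologicalType) (X : Omega -> T) : Prop :=
  forall B, borel_set B -> measurable (X @^-1` B).

Definition mutually_independent (I : choiceType) (T : topologicalType)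
    (X : I -> Omega -> T) : Prop :=
  forall (J : {fset I}) (B : I -> set T),
    (forall i, i \in J -> borel_set (B i)) ->
    P (\bigcap_(i in [set` J]) (X i @^-1` B i)) =
    (\prod_(i <- J) P (X i @^-1` B i))%E.

(* As the 2m signed basis vectors are distinct, the masses 1/(2m) sum to 1 and
   determine the law. *)
Definition uniform_signed_basis (m : nat) (Y : Omega -> 'rV[R]_m) : Prop :=
  random_element Y /\
  forall (b : bool) (k : 'I_m),
    P (Y @^-1` [set (-1) ^+ b *: delta_mx ord0 k]) = ((2 * m%:R)^-1)%:E.

(* [Y i j] is the vector usually written Y_{i,j+1}: the columns of the array
   are indexed from 0. *)
Definition iid_signed_basis (n m : nat)
    (Y : 'I_n -> nat -> Omega -> 'rV[R]_m) : Prop :=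
  (forall i j, uniform_signed_basis (Y i j)) /\
  mutually_independent (fun ij : 'I_n * nat => Y ij.1 ij.2).

End RandomVectors.

Section OperatorS.
Context {R : realType} {Omega : Type}.
Variables (p : R) (n m : nat) (Y : 'I_n -> nat -> Omega -> 'rV[R]_m).

Definition S_series (w : Omega) (i : 'I_n) : nat -> 'rV[R]_m :=
  series (fun j : nat => (j.+1%:R `^ p^-1)^-1 *: Y i j w).

(* For 1 <= p < 2 the series only converge almost surely, and [lim] takes a
   default value when its argument diverges, so [S_op w] is the intended
   operator only at the outcomes [w] satisfying this predicate. *)
Definition S_defined (w : Omega) : Prop := forall i, cvgn (S_series w i).

Definition S_op (w : Omega) (x : 'rV[R]_n) : 'rV[R]_m :=
  \sum_(i < n) x ord0 i *: limn (S_series w i).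

End OperatorS.

(* Main.v *)
Require Import Defs.
From HB Require Import structures.
From mathcomp Require Import all_boot all_order all_algebra finmap.
From mathcomp Require Import all_classical all_reals all_analysis.
From mathcomp Require Import measurable_realfun ring lra.

Set Implicit Arguments.
Unset Strict Implicit.
Unset Printing Implicit Defensive.

Import Order.TTheory GRing.Theory Num.Theory.
Import numFieldNormedType.Exports.

(** Write m = eta n and let S_N be the truncation of S to the terms j < N.
    The idea is to bound, for one fixed sparse x, the probability that
    Phi(x) = (m^(-1/q) |S_N x|_r)^r is too large or too small by exp(-a m), to
    sum these bounds over a grid of at most exp(a m / 2) sparse vectors, and to
    extend the estimate from the grid to all sparse vectors, since Phi is
    subadditive and r-homogeneous.

    Finite probability. S_N depends on finitely many independent signs and
    positions, all uniform, so an event about S_N is counted instead of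
    measured ([transfer]). If the bounds fail for S at an outcome where the
    series converges, then they fail for all large truncations at the same x,
    because the failure is a strict inequality. Hence the probability of
    failure for S is at most the supremum of those for S_N.

    One vector. After scaling by m^(1/p), the coefficients of S_N x have
    absolute values (M_i/(j+1))^(1/p) with M_i = m |x_i|^p, and sum M_i = m when
    |x|_p = 1.
    - Upper bound ([card_Phi_large]). The coefficients that are at least 1
      have r-th powers with sum O(m), because r < p; the other ones have
      squares with sum O(m), because p < 2. The l_1 norm of the random vector
      made from the small coefficients is a maximum over 2^m choices of signs s
      of sums of independent symmetric variables (its pairing with s), so
      Hoeffding's inequality and a union bound show that it is O(m), and
      |w|^r <= 1 + |w|.
    - Lower bound ([card_Phi_small]). If x has at most m/16 nonzero entries and
      1/8 <= |x|_p^p <= 1, at least m/16 coefficients are at least 1. Throwing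
      them into m bins at random, a fixed proportion of the bins gets one of
      them, with high probability. In such a bin, for any values of the other
      signs, at least one of the two signs of that coefficient gives a bin sum
      of absolute value at least 1; so a fixed proportion of the bin sums has
      absolute value at least 1, with high probability
      ([card_throw_few_large]).

    All sparse vectors. Rounding a sparse x towards 0 on a grid of mesh
    theta k^(-1/p), k = delta n, does not enlarge the support and moves x by at
    most theta in l_p. The grid has at most exp(k (log(1/delta) + K)) points
    with at most k nonzero entries in the unit ball ([card_sparse_codes]); this
    is below exp(a m / 2) if delta is a small enough multiple of
    eta / log(1 + 1/eta) ([sparsity_ok]). The passage from the grid to all
    sparse vectors is [sparse_bounds_of_grid].

    Convergence. The series defining S need not converge absolutely when
    p >= 1. The random walk with steps Y_ij grows at most like j^(1/2) log j by
    Hoeffding's inequality and the Borel-Cantelli lemma, and summation by parts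
    against j^(-1/p), where 1/p > 1/2, gives almost sure convergence
    ([S_defined_ae]).

    Measurability. For an outcome at which S is defined, both sides of the
    inequalities are continuous in x along each support, so rational x suffice
    ([measurable_all_bounds]). *)

Local Open Scope ring_scope.

(** * Elementary real inequalities *)

Section RealInequalities.
Context {R : realType}.
Implicit Types (x y a b s t r u : R).

Lemma powR_expR x a : 0 < x -> x `^ a = expR (a * ln x).
Proof. by move=> x0; rewrite /powR gt_eqF. Qed.

Lemma powRDp x a b : 0 < x -> x `^ (a + b) = x `^ a * x `^ b.
Proof. by move=> x0; rewrite powRD// (gt_eqF x0) implybT. Qed.

Lemma ln_ge_1BV x : 0 < x -> 1 - x^-1 <= ln x.
Proof.
move=> x0; have xi : 0 < x^-1 by rewrite invr_gt0.
have : ln (1 + (x^-1 - 1)) <= x^-1 - 1 by apply: le_ln1Dx; lra.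
rewrite [1 + _]addrC subrK lnV ?posrE//; lra.
Qed.

(** From [expR (- x / 2) >= 1 - x / 2], squared and inverted. The constant 3
    makes [9/4 - 11/4 x + 3/4 x ^ 2] nonnegative on the whole interval. *)
Lemma expR_le_quad x : `|x| <= 1 -> expR x <= 1 + x + 3 * x ^+ 2.
Proof.
rewrite ler_norml => /andP[x1 x2].
have h : 0 < 1 - x / 2 by lra.
have e1 : 1 - x / 2 <= expR (- (x / 2)).
  by apply: le_trans (expR_ge1Dx _); lra.
have e2 : (1 - x / 2) ^+ 2 * expR x <= 1.
  have -> : expR x = (expR (x / 2)) ^+ 2 by rewrite expr2 -expRD; congr expR; lra.
  rewrite -exprMn expr_le1//; last by rewrite mulr_ge0 ?expR_ge0// ltW.
  rewrite -[leRHS](expRxMexpNx_1 (x / 2)) mulrC ler_pM2l ?expR_gt0//.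
have h2 : 0 < (1 - x / 2) ^+ 2 by rewrite exprn_gt0.
rewrite -(ler_pM2l h2); apply: (le_trans e2).
have -> : (1 - x / 2) ^+ 2 * (1 + x + 3 * x ^+ 2) =
   1 + x ^+ 2 * (9/4 - 11/4 * x + 3/4 * x ^+ 2) by field.
rewrite lerDl mulr_ge0 ?sqr_ge0//; nra.
Qed.

(** A bound for the moment generating function of a random sign: the linear
    terms of [expR_le_quad] cancel, and [|x| <= 3 x ^ 2] if [|x| > 1]. *)
Lemma cosh_le x : expR x + expR (- x) <= 2 * expR (3 * x ^+ 2).
Proof.
have [x1|x1] := lerP `|x| 1.
  have h1 := expR_le_quad x1.
  have h2 : expR (- x) <= 1 + (- x) + 3 * (- x) ^+ 2.
    by apply: expR_le_quad; rewrite normrN.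
  have h3 := expR_ge1Dx (3 * x ^+ 2).
  rewrite sqrrN in h2; lra.
have xx : `|x| <= 3 * x ^+ 2.
  by rewrite -real_normK ?num_real//; nra.
have le1 : expR x <= expR (3 * x ^+ 2).
  by rewrite ler_expR; apply: le_trans xx; exact: ler_norm.
have le2 : expR (- x) <= expR (3 * x ^+ 2).
  by rewrite ler_expR; apply: le_trans xx; rewrite -normrN; exact: ler_norm.
lra.
Qed.

(** With [z = x / (x + y)] in the unit interval, [z <= z `^ r], and likewise
    for [1 - z]. *)
Lemma powR_subadd r x y : 0 < r -> r <= 1 -> 0 <= x -> 0 <= y ->
  (x + y) `^ r <= x `^ r + y `^ r.
Proof.
move=> r0 r1 x0 y0.
have [->|xy0] := eqVneq (x + y) 0.
  by rewrite powR0 ?gt_eqF// addr_ge0// powR_ge0.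
have xyp : 0 < x + y by rewrite lt_neqAle eq_sym xy0 addr_ge0.
have key z : 0 <= z -> z <= x + y -> z / (x + y) * (x + y) `^ r <= z `^ r.
  move=> z0 zxy.
  have -> : z `^ r = (z / (x + y)) `^ r * (x + y) `^ r.
    by rewrite -powRM ?divr_ge0 ?(ltW xyp)// divfK// gt_eqF.
  rewrite ler_wpM2r ?powR_ge0//.
  have [->|zn0] := eqVneq z 0; first by rewrite mul0r powR_ge0.
  have zp : 0 < z by rewrite lt_neqAle eq_sym zn0.
  by apply: ger1_powR r1; rewrite divr_gt0//= ler_pdivrMr// mul1r.
apply: le_trans (lerD (key x x0 _) (key y y0 _)); rewrite ?lerDl ?lerDr//.
by rewrite -mulrDl -mulrDl divff ?mul1r.
Qed.

Lemma normr_powR_subadd r x y : 0 < r -> r <= 1 ->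
  `|x + y| `^ r <= `|x| `^ r + `|y| `^ r.
Proof.
move=> r0 r1; apply: le_trans (powR_subadd r0 r1 _ _) => //.
by apply: ge0_ler_powR; rewrite ?nnegrE ?addr_ge0 ?(ltW r0)//; apply: ler_normD.
Qed.

(** A lower bound for the increment of a power, which makes the sums of powers
    below telescope. *)
Lemma powR_growth s t : 0 < s -> 0 < t ->
  t `^ s * (1 + s / (t + 1)) <= (t + 1) `^ s.
Proof.
move=> s0 t0; have t1 : 0 < t + 1 by lra.
have -> : (t + 1) `^ s = t `^ s * ((t + 1) / t) `^ s.
  rewrite -powRM ?(ltW t0) ?divr_ge0 ?(ltW t1) ?(ltW t0)//.
  by congr (_ `^ _); field; rewrite gt_eqF.
rewrite ler_wpM2l ?powR_ge0// powR_expR ?divr_gt0//.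
apply: le_trans (expR_ge1Dx _); rewrite lerD2l ler_wpM2l ?(ltW s0)//.
apply: le_trans (ln_ge_1BV _); rewrite ?divr_gt0// invf_div le_eqVlt.
by apply/orP; left; apply/eqP; field; rewrite gt_eqF.
Qed.

(** Each term is at most a multiple of [u `^ (1 - a) - (u + 1) `^ (1 - a)] with
    [u = j + 1], and these telescope from [u = t] on. The form in [t] is meant
    for the sum of [(t / (j + 1)) `^ a] over [j + 1 > t], which is [O(t)] for
    small [t] as well. *)
Lemma sum_powR_tail a t N : 1 < a -> 0 < t ->
  \sum_(j < N | t < j.+1%:R) j.+1%:R `^ (- a)
    <= 2 `^ a / (a - 1) * t `^ (1 - a).
Proof.
move=> a1 t0; set C := 2 `^ a / _.
have C0 : 0 < C by rewrite divr_gt0 ?powR_gt0//; lra.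
have step u : 1 <= u ->
    u `^ (- a) <= C * (u `^ (1 - a) - (u + 1) `^ (1 - a)).
  move=> u1; have u0 : 0 < u by lra.
  have u10 : 0 < u + 1 by lra.
  have g := @powR_growth (a - 1) u ltac:(lra) u0.
  have P1 := powR_gt0 (1 - a) u0.
  have P2 := powR_gt0 (1 - a) u10.
  have E1 : u `^ (1 - a) * u `^ (a - 1) = 1.
    rewrite -powRDp//.
    by have -> : 1 - a + (a - 1) = 0; [lra|rewrite powRr0].
  have E2 : (u + 1) `^ (1 - a) * (u + 1) `^ (a - 1) = 1.
    rewrite -powRDp//.
    by have -> : 1 - a + (a - 1) = 0; [lra|rewrite powRr0].
  have D : (u + 1) `^ (1 - a) * ((a - 1) / (u + 1)) <=
      u `^ (1 - a) - (u + 1) `^ (1 - a).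
    have := ler_wpM2l (ltW (mulr_gt0 P1 P2)) g.
    have -> : u `^ (1 - a) * (u + 1) `^ (1 - a) *
       (u `^ (a - 1) * (1 + (a - 1) / (u + 1))) =
      (u `^ (1 - a) * u `^ (a - 1)) * ((u + 1) `^ (1 - a) + (u + 1) `^ (1 - a) * ((a - 1) / (u + 1))).
      by ring.
    have -> : u `^ (1 - a) * (u + 1) `^ (1 - a) * (u + 1) `^ (a - 1) =
      u `^ (1 - a) * ((u + 1) `^ (1 - a) * (u + 1) `^ (a - 1)) by ring.
    rewrite E1 E2; lra.
  apply: le_trans (ler_wpM2l (ltW C0) D).
  have -> : (u + 1) `^ (1 - a) * ((a - 1) / (u + 1)) = (a - 1) * (u + 1) `^ (- a).
    rewrite powRDp// powRr1 ?(ltW u10)//.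
    by field; rewrite gt_eqF.
  rewrite mulrA divfK; last by rewrite subr_eq0 gt_eqF.
  rewrite !powRN -ler_pdivrMl ?powR_gt0// mulrC.
  rewrite -invfM -powRM ?(ltW u0)//.
  rewrite lef_pV2 ?posrE ?powR_gt0//; last by lra.
  by apply: ge0_ler_powR; rewrite ?nnegrE; lra.
rewrite (big_mkcond (fun j : 'I_N => t < j.+1%:R)).
suff H : \sum_(j < N) (if t < j.+1%:R then j.+1%:R `^ (- a) else 0) <=
   C * (t `^ (1 - a) - (Num.max t N.+1%:R) `^ (1 - a)).
  by apply: le_trans H _; rewrite ler_wpM2l ?(ltW C0)// lerBlDr lerDl powR_ge0.
have anti x y : 0 < x -> x <= y -> y `^ (1 - a) <= x `^ (1 - a).
  move=> x0 xy; have y0 : 0 < y by apply: lt_le_trans xy.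
  have -> : 1 - a = - (a - 1) by lra.
  rewrite !powRN lef_pV2 ?posrE ?powR_gt0//.
  by apply: ge0_ler_powR; rewrite ?nnegrE ?(ltW x0) ?(ltW y0)//; lra.
(* The maximum with [t] makes the bound constant while the terms are skipped. *)
elim: N => [|N IH].
  rewrite big_ord0 mulr_ge0 ?(ltW C0)// subr_ge0 anti// le_max lexx//.
rewrite big_ord_recr /=; case: ifPn => [tN|]; last first.
  rewrite -leNgt => tN; rewrite addr0; apply: le_trans IH _.
  rewrite ler_wpM2l ?(ltW C0)// lerD2l lerN2 anti// ?lt_max ?t0//.
  rewrite ge_max !le_max lexx/= ler_nat leqnSn orbT//.
have := step N.+1%:R; rewrite -{1}[1](mulr1n 1) ler_nat => /(_ isT) st.
have tN2 : t < N.+2%:R by apply: lt_le_trans tN _; rewrite ler_nat.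
move: IH; rewrite (max_idPr (ltW tN)) (max_idPr (ltW tN2)).
have -> : N.+2%:R = N.+1%:R + 1 :> R by rewrite -natr1.
move: st; set X := \sum_(_ < _) _; lra.
Qed.

(** The same telescoping as for the tail; the sum of [(t / (j + 1)) `^ a] over
    [j + 1 <= t] is [O(t)]. *)
Lemma sum_powR_head a t N : 0 < a -> a < 1 -> 0 < t ->
  \sum_(j < N | j.+1%:R <= t) j.+1%:R `^ (- a)
    <= 4 / (1 - a) * t `^ (1 - a).
Proof.
move=> a0 a1 t0; pose s := 1 - a.
have s0 : 0 < s by rewrite /s; lra.
have C0 : 0 < 2 / s by rewrite divr_gt0.
have step u : 1 <= u ->
    u `^ (- a) <= 2 / s * ((u + 1) `^ s - u `^ s).
  move=> u1; have u0 : 0 < u by lra.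
  have g := @powR_growth s u s0 u0.
  have P1 := powR_gt0 (- a) u0.
  have D : u `^ s * (s / (u + 1)) <= (u + 1) `^ s - u `^ s by lra.
  apply: le_trans (ler_wpM2l (ltW C0) D).
  have -> : u `^ s = u `^ (- a) * u.
    by rewrite -[X in _ * X](powRr1 (ltW u0)) -powRDp// addrC.
  have -> : 2 / s * (u `^ (- a) * u * (s / (u + 1))) =
     u `^ (- a) * (2 * u / (u + 1)).
    by field; rewrite gt_eqF//=; lra.
  rewrite ler_peMr ?(ltW P1)// ler_pdivlMr; lra.
have mon x y : 0 <= x -> x <= y -> x `^ s <= y `^ s.
  by move=> x0 xy; apply: ge0_ler_powR; rewrite ?nnegrE ?(ltW s0)//; apply: le_trans xy.
have [t1|t1] := ltrP t 1.
  rewrite big_pred0; first by rewrite mulr_ge0 ?powR_ge0// divr_ge0//; lra.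
  by move=> j; apply/negbTE; rewrite -ltNge; apply: lt_le_trans t1 _; rewrite ler1n.
rewrite (big_mkcond (fun j : 'I_N => j.+1%:R <= t)).
suff H : \sum_(j < N) (if j.+1%:R <= t then j.+1%:R `^ (- a) else 0) <=
   2 / s * (Num.min (t + 1) N.+1%:R) `^ s.
  apply: (le_trans H); have -> : 4 / (1 - a) = 2 / s * 2 by rewrite /s; field; lra.
  rewrite -[leRHS]mulrA ler_wpM2l ?(ltW C0)//.
  apply: (@le_trans _ _ ((2 * t) `^ s)).
    apply: mon; first by rewrite le_min ler0n andbT; lra.
    by rewrite ge_min; apply/orP; left; lra.
  rewrite powRM ?(ltW t0)// ler_wpM2r ?powR_ge0//.
  by apply: ler1_powR; rewrite /s; lra.
elim: N => [|N IH].
  by rewrite big_ord0 mulr_ge0 ?powR_ge0// ltW.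
rewrite big_ord_recr /=; case: ifPn => [tN|]; last first.
  rewrite -ltNge => tN; rewrite addr0; apply: le_trans IH _.
  rewrite ler_wpM2l ?(ltW C0)// mon//.
    by rewrite le_min ler0n andbT; lra.
  by rewrite le_min !ge_min lexx ler_nat leqnSn orbT.
have := step N.+1%:R; rewrite -{1}[1](mulr1n 1) ler_nat => /(_ isT) st.
have E2 : N.+2%:R = N.+1%:R + 1 :> R by rewrite -natr1.
have tN2 : N.+2%:R <= t + 1 by lra.
have tN1 : N.+1%:R <= t + 1 by lra.
move: IH; rewrite (min_idPr tN1) (min_idPr tN2) E2.
move: st; set X := \sum_(_ < _) _; lra.
Qed.

Lemma sum_inv_sqr_le8 N : \sum_(j < N) j.+1%:R `^ (- 2) <= 8 :> R.
Proof.
have := @sum_powR_tail 2 (1 / 2) N ltac:(lra) ltac:(lra).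
rewrite (eq_bigl xpredT) => [|j]; last first.
  by rewrite (@lt_le_trans _ _ 1)//; [lra|rewrite ler1n].
move=> h; apply: (le_trans h).
have -> : 1 - 2 = -1 :> R by lra.
have -> : (1 / 2) `^ (-1) = 2 :> R by rewrite powR_inv1; [field|lra].
have -> : 2 - 1 = 1 :> R by lra.
by rewrite powR_mulrn// divr1; lra.
Qed.

End RealInequalities.

(** * Counting signs and positions *)

Section Counting.
Context {R : realType}.

Lemma card_set_sum (T : finType) (P : pred T) :
  (#|[set x | P x]%SET|)%:R = \sum_x (P x)%:R :> R.
Proof.
rewrite -sum1_card natr_sum big_mkcond /=.
by apply: eq_bigr => x _; rewrite inE; case: (P x).
Qed.

(** The union bound. *)
Lemma card_le_cover (T K : finType) (P : pred T) (Q : pred K) (B : K -> pred T) :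
  (forall x, P x -> exists2 k, Q k & B k x) ->
  (#|[set x | P x]%SET|)%:R <= \sum_(k | Q k) (#|[set x | B k x]%SET|)%:R :> R.
Proof.
move=> h; under [leRHS]eq_bigr do rewrite card_set_sum.
rewrite card_set_sum exchange_big /=; apply: ler_sum => x _.
case: (boolP (P x)) => [/h[k Qk Bkx]|_]; last by rewrite sumr_ge0.
by rewrite (bigD1 k)//= Bkx lerDl sumr_ge0.
Qed.

Lemma card_set_pair (T U : finType) (Q : pred (T * U)) :
  (#|[set x | Q x]%SET|)%:R = \sum_u (#|[set t | Q (t, u)]%SET|)%:R :> R.
Proof.
rewrite card_set_sum (eq_bigr (fun x => (Q (x.1, x.2))%:R)) => [|[]//].
rewrite -(pair_bigA _ (fun t u => (Q (t, u))%:R)) exchange_big /=.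
by apply: eq_bigr => u _; rewrite card_set_sum.
Qed.

(** Hoeffding's inequality for random signs: exponential Markov inequality, and
    the sum over [e] of the exponentials factors over the indices. The usual free
    parameter is absorbed in [b] and [t]. *)
Lemma card_sign_tail (I : finType) (b : I -> R) t :
  (#|[set e : {ffun I -> bool} | t < \sum_i b i * (-1) ^+ e i]%SET|)%:R
    <= 2 ^+ #|I| * expR (- t + 3 * \sum_i b i ^+ 2).
Proof.
rewrite card_set_sum.
apply: (@le_trans _ _ (\sum_(e : {ffun I -> bool})
    expR (- t) * \prod_i expR (b i * (-1) ^+ e i))).
  apply: ler_sum => e _; rewrite -expR_sum -expRD.
  case: ltP => h /=; last by rewrite expR_ge0.
  by rewrite -[leLHS]expR0 ler_expR; lra.
rewrite -mulr_sumr expRD mulrCA ler_wpM2l ?expR_ge0//.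
rewrite -(bigA_distr_bigA (fun i (c : bool) => expR (b i * (-1) ^+ c))) /=.
rewrite mulr_sumr expR_sum -prodr_const -big_split /=.
apply: ler_prod => i _; rewrite sumr_ge0 => [|? _]; last exact: expR_ge0.
by rewrite big_bool /= expr0 expr1 mulr1 mulrN1 addrC cosh_le.
Qed.

Variables (I : finType) (m : nat) (b : I -> R).
Implicit Types (e : {ffun I -> bool}) (kap : {ffun I -> 'I_m}).

(** The [k]-th coordinate of the random vector whose [i]-th summand is
    [b i] times the basis vector of index [kap i], with sign given by [e i]. *)
Definition throw (e : {ffun I -> bool}) (kap : {ffun I -> 'I_m}) (k : 'I_m) : R :=
  \sum_(i | kap i == k) b i * (-1) ^+ e i.

(** The l_1 norm of the throw is the largest of its pairings with a sign vector
    [s], and each pairing is a sum of random signs with coefficients of the same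
    absolute values as [b]. *)
Lemma card_throw_l1_tail kap t :
  (#|[set e | t < \sum_k `|throw e kap k|]%SET|)%:R
    <= 2 ^+ m * (2 ^+ #|I| * expR (- t + 3 * \sum_i b i ^+ 2)).
Proof.
pose B (s : {ffun 'I_m -> bool}) :=
  [pred e : {ffun I -> bool} | t < \sum_i (b i * (-1) ^+ s (kap i)) * (-1) ^+ e i].
apply: le_trans (card_le_cover (Q := predT) (B := B) _) _.
  move=> e he; exists [ffun k => throw e kap k < 0] => //=.
  apply: lt_le_trans he _; rewrite le_eqVlt; apply/orP; left; apply/eqP.
  rewrite (partition_big kap xpredT)//=; apply: eq_bigr => k _.
  rewrite {1}/throw; case: (ltrP (throw e kap k) 0) => h.
    rewrite ltr0_norm// /throw -sumrN; apply: eq_bigr => i /eqP ik.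
    by rewrite ik ffunE h expr1; ring.
  rewrite ger0_norm// /throw; apply: eq_bigr => i /eqP ik.
  by rewrite ik ffunE ltNge h expr0; ring.
apply: (@le_trans _ _ (\sum_(s : {ffun 'I_m -> bool})
    2 ^+ #|I| * expR (- t + 3 * \sum_i b i ^+ 2))).
  apply: ler_sum => s _.
  apply: le_trans (card_sign_tail (fun i => b i * (-1) ^+ s (kap i)) t) _.
  rewrite le_eqVlt; apply/orP; left; apply/eqP; congr (_ * expR (_ + _ * _)).
  by apply: eq_bigr => i _; rewrite exprMn sqrr_sign mulr1.
by rewrite sumr_const card_ffun card_bool card_ord -[leLHS]mulr_natl natrX.
Qed.

Lemma card_throw_l1_tail_pair t :
  (#|[set ek : {ffun I -> bool} * {ffun I -> 'I_m} |
       t < \sum_k `|throw ek.1 ek.2 k|]%SET|)%:R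
    <= 2 ^+ m * expR (- t + 3 * \sum_i b i ^+ 2) * (2 ^+ #|I| * m%:R ^+ #|I|).
Proof.
rewrite card_set_pair /=.
apply: le_trans (ler_sum _ (fun kap _ => card_throw_l1_tail kap t)) _.
rewrite sumr_const card_ffun card_ord -[leLHS]mulr_natl natrX.
by rewrite le_eqVlt; apply/orP; left; apply/eqP; ring.
Qed.

(** Choose in each occupied bin outside [A] one index of [J]; they form [D].
    Changing the sign of such an index moves the bin sum by at least 2, so it
    cannot stay in the open interval from -1 to 1. Hence the signs outside [D]
    determine the signs in [D]. *)
Lemma card_throw_small kap (J : {set I}) (A : {set 'I_m}) :
  (forall i, i \in J -> 1 <= `|b i|) ->
  (#|[set e | [forall k, (k \notin A) ==> (`|throw e kap k|%R < 1)%R]]%SET|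
     * 2 ^ #|(kap @: J) :\: A| <= 2 ^ #|I|)%N.
Proof.
move=> hJ; set X := [set e | _]%SET.
pose D := [set i in J | (kap i \notin A) &&
  ([pick j in J | kap j == kap i] == Some i)]%SET.
have injD : {in D &, injective kap}.
  move=> i j; rewrite !inE => /and3P[_ _ /eqP pi] /and3P[_ _ /eqP pj] eij.
  by move: pi; rewrite eij pj => -[].
have imD : kap @: D = (kap @: J :\: A)%SET.
  apply/setP => k; apply/imsetP/setDP.
    move=> [i]; rewrite inE => /and3P[iJ iA _] ->; split => //.
    by apply/imsetP; exists i.
  move=> [/imsetP[i iJ ->] kA].
  case E : [pick j in J | kap j == kap i] => [j|]; last first.
    by move: E; case: pickP => // /(_ i); rewrite iJ eqxx.
  have : (j \in J) && (kap j == kap i) by move: E; case: pickP => // ? ? [<-].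
  move=> /andP[jJ /eqP ij]; exists j => //.
  by rewrite inE jJ ij kA E eqxx.
have cD : #|D| = #|(kap @: J) :\: A| by rewrite -imD card_in_imset.
pose mask e : {ffun I -> bool} := [ffun i => (i \notin D) && e i].
have injm : {in X &, injective mask}.
  move=> e e'; rewrite !inE => /forallP he /forallP he' /ffunP mm.
  have offD i : i \notin D -> e i = e' i.
    by move=> iD; have := mm i; rewrite !ffunE iD.
  apply/ffunP => i; have [iD|] := boolP (i \in D); last exact: offD.
  apply/eqP/negPn/negP => ne.
  have iJ : i \in J by move: iD; rewrite inE => /andP[].
  have iA : kap i \notin A by move: iD; rewrite inE => /and3P[].
  have dif : throw e kap (kap i) - throw e' kap (kap i) =
     b i * ((-1) ^+ e i - (-1) ^+ e' i).
    rewrite /throw -sumrB (bigD1 i)//= big1 ?addr0 ?mulrBr// => j /andP[/eqP jk ji].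
    rewrite offD ?subrr//; apply: contra ji => jD; apply/eqP; exact: injD.
  have sg2 : `|(-1) ^+ e i - (-1) ^+ e' i| = 2 :> R.
    case: (e i) (e' i) ne => -[]//= _; rewrite expr0 expr1.
      by rewrite ler0_norm; lra.
    by rewrite ger0_norm; lra.
  have := congr1 Num.norm dif; rewrite normrM sg2.
  have h1 := ler_normB (throw e kap (kap i)) (throw e' kap (kap i)).
  move: (implyP (he (kap i)) iA) (implyP (he' (kap i)) iA) (hJ _ iJ); lra.
have le1 : (#|X| <= 2 ^ #|~: D|)%N.
  rewrite -(card_in_imset injm) -card_bool -[#|{: bool}|]/#|predT : {pred bool}|.
  rewrite -(card_pffun_on false).
  apply: subset_leq_card; apply/fintype.subsetP => _ /imsetP[e _ ->].
  apply/pffun_onP; split => //; apply/fintype.subsetP => i.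
  by rewrite inE [i \in ~: D]inE /= ffunE; case: (i \in D).
by rewrite -cD -(cardsC D) addnC expnD leq_mul2r le1 orbT.
Qed.

Lemma card_maps_into (J : {set I}) (A : {set 'I_m}) :
  #|[set kap : {ffun I -> 'I_m} | [forall i in J, kap i \in A]]%SET|
    = (#|A| ^ #|J| * m ^ #|~: J|)%N.
Proof.
rewrite -sum1_card big_mkcond /=.
transitivity (\sum_(kap : {ffun I -> 'I_m}) \prod_i ((i \in J) ==> (kap i \in A) : nat))%N.
  apply: eq_bigr => kap _; rewrite inE; case: ifPn => [/forallP h|].
    by rewrite big1// => i _; rewrite h.
  rewrite negb_forall => /existsP[i /negbTE h].
  by rewrite (bigD1 i)//= h mul0n.
rewrite -(bigA_distr_bigA (fun i (k : 'I_m) => ((i \in J) ==> (k \in A) : nat))) /=.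
rewrite (bigID (mem J)) /=; congr (_ * _)%N.
  under eq_bigr => i iJ.
    rewrite iJ /=; under eq_bigr do rewrite -[nat_of_bool _]/(nat_of_bool (_ \in A)).
    rewrite -(big_mkcond (mem A) (fun=> 1%N)) sum1_card; over.
  by rewrite prod_nat_const.
under eq_bigr => i iJ.
  rewrite (negbTE iJ) /= sum1_card card_ord; over.
rewrite (eq_bigl (mem (~: J)%SET)) => [|i]; last by rewrite /= !inE.
by rewrite prod_nat_const.
Qed.

(** Each set [A] is given the weight [z `^ (#|A| - c)], which is at least 1 if
    [#|A| <= c]; the weights sum to a product over the points. *)
Lemma card_subsets_le (z c : R) : 0 < z -> z <= 1 ->
  (#|[set A : {set 'I_m} | #|A|%:R <= c]%SET|)%:R <= z `^ (- c) * (1 + z) ^+ m.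
Proof.
move=> z0 z1.
rewrite card_set_sum.
apply: (@le_trans _ _ (\sum_(A : {set 'I_m}) z `^ (- c) * \prod_(k : 'I_m) (if k \in A then z else 1))).
  apply: ler_sum => A _; rewrite -big_mkcond /= prodr_const.
  rewrite -powR_mulrn ?(ltW z0)// -powRDp//.
  case: (lerP #|A|%:R c) => h /=; last by rewrite powR_ge0.
  rewrite -[leLHS](powRr0 z); apply: ger_powR; first by rewrite z0.
  by rewrite addrC subr_le0.
rewrite -mulr_sumr ler_wpM2l ?powR_ge0// -(@bigA_distr _ _ _ _ _ _ (fun=> z) (fun=> 1)) /=.
by rewrite prodr_const card_ord addrC.
Qed.

(** Serves both as the guaranteed proportion of bins with a large sum and as an
    exponential rate. It is sealed so that conversion never expands the
    numeral. *)
Definition tiny : R := locked 4096^-1.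

Lemma tinyE : tiny = 4096^-1. Proof. by rewrite /tiny -lock. Qed.

Lemma tiny_gt0 : 0 < tiny. Proof. by rewrite tinyE invr_gt0 ltr0n. Qed.

Lemma tiny_le2 : tiny <= 2^-1.
Proof. by rewrite tinyE lef_pV2 ?posrE ?ltr0n// ler_nat. Qed.

(** Either the indices of [J] occupy at most [tau m] bins, with [tau = 1/64]:
    then they all fall into a small set [A] of bins, and for each [A] this has
    probability at most [tau ^ #|J|]. Or more than [tau m] bins are occupied
    while at most [rho m] bin sums are large, with [rho = 1/4096]: then
    [card_throw_small] applies to the set [A] of the large ones, with a gain of
    [2 ^ ((tau - rho) m)]. In both cases the number of the sets [A] is too small
    to compensate. *)
Lemma card_throw_few_large (J : {set I}) : (0 < m)%N ->
  m%:R / 16 <= #|J|%:R :> R -> (forall i, i \in J -> 1 <= `|b i|) ->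
  (#|[set ek : {ffun I -> bool} * {ffun I -> 'I_m} |
      #|[set k | 1 <= `|throw ek.1 ek.2 k|]%SET|%:R <= tiny * m%:R]%SET|)%:R
   <= 2 * expR (- (2 * tiny * m%:R)) * (2 ^+ #|I| * m%:R ^+ #|I|) :> R.
Proof.
move=> m0 Jm hJ; rewrite tinyE; pose tau : R := 64^-1; pose rho : R := 4096^-1.
pose Large e kap := [set k | 1 <= `|throw e kap k|]%SET.
have mR : 0 < m%:R :> R by rewrite ltr0n.
have ln2 : 1 / 2 <= ln 2 :> R.
  by have := @ln_ge_1BV R 2 ltac:(lra); lra.
have lnpow k : ln (2 ^+ k : R) = k%:R * ln 2 by rewrite lnXn// mulr_natl.
have etau : tau = expR (- (6 * ln 2)).
  by rewrite expRN -(lnpow 6%N) lnK ?posrE ?exprn_gt0// /tau; congr (_^-1); ring.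
have erho : rho = expR (- (12 * ln 2)).
  by rewrite expRN -(lnpow 12%N) lnK ?posrE ?exprn_gt0// /rho; congr (_^-1); ring.
have subsets_exp (s : R) : 0 <= s ->
    (#|[set A : {set 'I_m} | #|A|%:R <= expR (- s) * m%:R]%SET|)%:R
      <= expR (expR (- s) * (s + 1) * m%:R).
  move=> s0; have es1 : expR (- s) <= 1 by rewrite expR_le1 oppr_le0.
  apply: le_trans (card_subsets_le _ (expR_gt0 _) es1) _.
  rewrite -expRM -mulNr.
  have h : (1 + expR (- s)) ^+ m <= expR (expR (- s) * m%:R).
    rewrite expRM_natr lerXn2r ?nnegrE ?expR_ge0 ?addr_ge0 ?expR_ge0//.
    exact: expR_ge1Dx.
  apply: le_trans (ler_wpM2l (expR_ge0 _) h) _.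
  rewrite -expRD ler_expR; lra.

pose hit (ek : {ffun I -> bool} * {ffun I -> 'I_m}) := (ek.2 @: J)%SET.
pose Q (c : bool) : pred ({ffun I -> bool} * {ffun I -> 'I_m}) := fun ek =>
  if c then #|hit ek|%:R <= tau * m%:R else
  (tau * m%:R < #|hit ek|%:R) && (#|Large ek.1 ek.2|%:R <= rho * m%:R).
apply: le_trans (card_le_cover (Q := predT) (B := Q) _) _.
  move=> ek h; case: (lerP #|hit ek|%:R (tau * m%:R)) => hh.
    by exists true.
  by exists false => //; rewrite /Q hh.
rewrite big_bool.
have few_bins : (#|[set ek | Q true ek]%SET|)%:R
    <= expR (- (2 * rho * m%:R)) * (2 ^+ #|I| * m%:R ^+ #|I|) :> R.
  pose into (A : {set 'I_m}) : pred ({ffun I -> bool} * {ffun I -> 'I_m}) :=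
    fun ek => [forall i in J, ek.2 i \in A].
  apply: le_trans (card_le_cover (B := into)
     (Q := fun A : {set 'I_m} => #|A|%:R <= tau * m%:R) _) _.
    move=> ek h; exists (hit ek) => //.
    by apply/forall_inP => i iJ; apply/imsetP; exists i.
  apply: (@le_trans _ _ (\sum_(A : {set 'I_m} | #|A|%:R <= tau * m%:R)
     expR (- (6 * ln 2 * (m%:R / 16))) * (2 ^+ #|I| * m%:R ^+ #|I|))).
    apply: ler_sum => A hA; rewrite card_set_pair.
    have -> : \sum_(kap : {ffun I -> 'I_m})
        (#|[set e : {ffun I -> bool} | into A (e, kap)]%SET|)%:R =
        2 ^+ #|I| * (#|A|%:R ^+ #|J| * m%:R ^+ #|~: J|) :> R.
      rewrite -!natrX -natrM -card_maps_into card_set_sum mulr_sumr.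
      apply: eq_bigr => kap _; rewrite -natrM.
      congr (_%:R); rewrite -[X in (X ^ _)%N]card_bool -card_ffun /into /=.
      case: [forall i in J, kap i \in A]; rewrite ?muln1 ?muln0.
        by apply: eq_card => e; rewrite inE.
      by apply: eq_card0 => e; rewrite inE.
    rewrite [leRHS]mulrCA ler_wpM2l ?exprn_ge0//.
    have -> : expR (- (6 * ln 2 * (m%:R / 16))) * m%:R ^+ #|I| =
      (expR (- (6 * ln 2 * (m%:R / 16))) * m%:R ^+ #|J|) * m%:R ^+ #|~: J| :> R.
      by rewrite -(cardsC J) exprD mulrA.
    rewrite ler_wpM2r ?exprn_ge0//.
    apply: (@le_trans _ _ ((tau * m%:R) ^+ #|J|)).
      by rewrite lerXn2r ?nnegrE// mulr_ge0// ltW// /tau invr_gt0.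
    rewrite exprMn ler_wpM2r ?exprn_ge0// etau -expRM_natr ler_expR.
    rewrite mulNr lerN2 ler_wpM2l// mulr_ge0//; lra.
  rewrite sumr_const -[leLHS]mulr_natl mulrA ler_wpM2r ?mulr_ge0 ?exprn_ge0//.
  have := subsets_exp (6 * ln 2) ltac:(lra); rewrite -etau => h.
  rewrite cardsE in h; apply: le_trans (ler_wpM2r (expR_ge0 _) h) _.
  rewrite -expRD ler_expR /tau /rho; nra.
have few_large : (#|[set ek | Q false ek]%SET|)%:R
    <= expR (- (2 * rho * m%:R)) * (2 ^+ #|I| * m%:R ^+ #|I|) :> R.
  pose off (A : {set 'I_m}) : pred ({ffun I -> bool} * {ffun I -> 'I_m}) :=
    fun ek => (tau * m%:R < #|hit ek|%:R) &&
      [forall k, (k \notin A) ==> (`|throw ek.1 ek.2 k| < 1)%R].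
  apply: le_trans (card_le_cover (B := off)
     (Q := fun A : {set 'I_m} => #|A|%:R <= rho * m%:R) _) _.
    move=> ek /andP[h1 h2]; exists (Large ek.1 ek.2) => //; rewrite /off h1 /=.
    by apply/forallP => k; rewrite inE -ltNge implybb.
  apply: (@le_trans _ _ (\sum_(A : {set 'I_m} | #|A|%:R <= rho * m%:R)
     expR (- (ln 2 * ((tau - rho) * m%:R))) * (2 ^+ #|I| * m%:R ^+ #|I|))).
    apply: ler_sum => A hA; rewrite card_set_pair.
    have -> : m%:R ^+ #|I| = \sum_(kap : {ffun I -> 'I_m}) 1 :> R.
      by rewrite sumr_const card_ffun card_ord natrX.
    rewrite !mulr_sumr; apply: ler_sum => kap _; rewrite mulr1.
    have [hk|hk] := ltrP (tau * m%:R) (#|kap @: J|%:R : R); last first.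
      rewrite eq_card0 ?mulr_ge0 ?expR_ge0 ?exprn_ge0// => e.
      by rewrite !inE /off /hit /= ltNge hk.
    have cs := card_throw_small kap A hJ.
    have -> : [set e | off A (e, kap)]%SET =
      [set e | [forall k, (k \notin A) ==> (`|throw e kap k|%R < 1)%R]]%SET.
      by apply/setP => e; rewrite !inE /off /hit /= hk.
    move: cs; set X := #|_|; set c := #|_ :\: _| => cs.
    have cle : (tau - rho) * m%:R <= c%:R.
      have : (#|kap @: J|%N <= c + #|A|)%N.
        rewrite /c -(cardsID A (kap @: J)) addnC leq_add2l.
        by apply: subset_leq_card; apply: subsetIr.
      rewrite -(ler_nat R) natrD; move: hA hk; rewrite mulrBl; lra.
    have cs' : X%:R * 2 ^+ c <= 2 ^+ #|I| :> R.
      by rewrite -!natrX -natrM ler_nat.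
    have p2 : expR (ln 2 * c%:R) = 2 ^+ c :> R.
      by rewrite expRM_natr lnK ?posrE.
    have p3 : expR (ln 2 * ((tau - rho) * m%:R)) <= 2 ^+ c.
      by rewrite -p2 ler_expR ler_wpM2l//; lra.
    rewrite expRN mulrC ler_pdivlMr ?expR_gt0//.
    by apply: le_trans cs'; rewrite ler_wpM2l.
  rewrite sumr_const -[leLHS]mulr_natl mulrA ler_wpM2r ?mulr_ge0 ?exprn_ge0//.
  have := subsets_exp (12 * ln 2) ltac:(lra); rewrite -erho => h.
  rewrite cardsE in h; apply: le_trans (ler_wpM2r (expR_ge0 _) h) _.
  rewrite -expRD ler_expR /tau /rho; nra.
apply: le_trans (lerD few_bins few_large) _; lra.
Qed.

End Counting.

Local Open Scope classical_set_scope.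
Local Open Scope ring_scope.

(** * A grid of sparse vectors *)

Section Grid.
Context {R : realType}.
Variables (p : R) (n : nat).
Hypothesis p0 : 0 < p.
Implicit Types (x y : 'rV[R]_n).

Definition psum (s : R) (x : 'rV[R]_n) : R := \sum_(i < n) `|x ord0 i| `^ s.

Lemma psum_ge0 s x : 0 <= psum s x.
Proof. by apply: sumr_ge0 => i _; rewrite powR_ge0. Qed.

Lemma psum_eq0 x : (psum p x == 0) = (x == 0).
Proof.
apply/eqP/eqP => [|->]; last first.
  by rewrite /psum big1// => i _; rewrite mxE normr0 powR0// gt_eqF.
move=> /psumr_eq0P h; apply/rowP => i; rewrite mxE.
have /powR_eq0_eq0/eqP : `|x ord0 i| `^ p = 0 by apply: h => // j _; rewrite powR_ge0.
by rewrite normr_eq0 => /eqP.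
Qed.

Lemma psumZ s a x : psum s (a *: x) = `|a| `^ s * psum s x.
Proof.
by rewrite /psum mulr_sumr; apply: eq_bigr => i _; rewrite mxE normrM powRM.
Qed.

Lemma supp_scale_sub a x : (supp (a *: x) \subset supp x)%SET.
Proof.
apply/fintype.subsetP => i; rewrite !inE mxE; apply: contra => /eqP ->.
by rewrite mulr0.
Qed.

Lemma sparse_sub t x y : (supp y \subset supp x)%SET -> sparse t x -> sparse t y.
Proof. by move=> s; apply: le_trans; rewrite ler_nat subset_leq_card. Qed.

Lemma psum_normalize t x : sparse t x -> x != 0 ->
  exists u : 'rV[R]_n,
    [/\ x = psum p x `^ p^-1 *: u, psum p u = 1 & sparse t u].
Proof.
move=> xt x0; have sx : 0 < psum p x by rewrite lt_neqAle eq_sym psum_eq0 x0 psum_ge0.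
have tx : 0 < psum p x `^ p^-1 by rewrite powR_gt0.
exists ((psum p x `^ p^-1)^-1 *: x); split.
- by rewrite scalerA divff ?scale1r// gt_eqF.
- rewrite psumZ ger0_norm ?invr_ge0 ?(ltW tx)//.
  rewrite -powR_inv1 ?(ltW tx)// -powRrM mulN1r powRN -powRrM mulVf ?gt_eqF//.
  by rewrite powRr1 ?psum_ge0// mulVf// gt_eqF.
exact: sparse_sub (supp_scale_sub _ _) xt.
Qed.

Lemma psum1_le1 x i : psum p x = 1 -> `|x ord0 i| <= 1.
Proof.
move=> h; rewrite leNgt; apply/negP => xi.
have : `|x ord0 i| `^ p <= 1.
  by rewrite -h /psum (bigD1 i)//= lerDl sumr_ge0// => j _; rewrite powR_ge0.
rewrite leNgt => /negP; apply.
by apply: le_lt_trans (gt0_ltr_powR p0 _ _ xi); rewrite ?nnegrE ?powR1.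
Qed.

(** A code for the signed integers of absolute value at most [B]. Zero has a
    single code: with two of them, the number of codes of a sparse vector would
    grow like [2 ^ n]. *)
Definition code (B : nat) := option (bool * 'I_B).

Definition cval B (v : code B) : R :=
  if v is Some (c, a) then (-1) ^+ c * a.+1%:R else 0.

Definition cabs B (v : code B) : R := if v is Some (c, a) then a.+1%:R else 0.

Lemma cval_norm B (v : code B) : `|cval v| = cabs v.
Proof. by case: v => [[c a]|]; rewrite /= ?normr0// normrMsign ger0_norm. Qed.

Definition grid_point (h : R) B (z : {ffun 'I_n -> code B}) : 'rV[R]_n :=
  \row_i (h * cval (z i)).

Definition csupp B (z : {ffun 'I_n -> code B}) : {set 'I_n} :=
  [set i | z i != None]%SET.

Lemma psum_grid_point h B (z : {ffun 'I_n -> code B}) : 0 <= h ->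
  psum p (grid_point h z) = h `^ p * \sum_i cabs (z i) `^ p.
Proof.
move=> h0; rewrite /psum mulr_sumr; apply: eq_bigr => i _.
by rewrite mxE normrM cval_norm powRM ?(ger0_norm h0)//; case: (z i) => [[]|].
Qed.

(** Rounding towards zero keeps the point in the unit ball and does not enlarge
    the support. *)
Lemma round_to_grid h B x : 0 < h -> h^-1 <= B%:R ->
  (forall i, `|x ord0 i| <= 1) ->
  exists z : {ffun 'I_n -> code B},
    [/\ csupp z \subset supp x,
        forall i, `|grid_point h z ord0 i| <= `|x ord0 i| &
        forall i, `|(x - grid_point h z) ord0 i| <= h].
Proof.
move=> h0 hB x1.
have ex (t : R) : `|t| <= 1 -> exists v : code B,
   [/\ t = 0 -> v = None, `|h * cval v| <= `|t| & `|t - h * cval v| <= h].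
  move=> t1; pose a := Num.truncn (`|t| / h).
  have /truncn_itv/andP[a1 a2] : 0 <= `|t| / h by rewrite divr_ge0// ltW.
  rewrite -/a in a1 a2; rewrite ler_pdivlMr// in a1; rewrite ltr_pdivrMr// in a2.
  case: (posnP a) => [a0|a0].
    exists None; split => //=; rewrite mulr0 ?normr0// subr0.
    by move: a2; rewrite a0 mul1r; apply: ltW.
  have aB : (a.-1 < B)%N.
    rewrite prednK// -(ler_nat R); apply: le_trans hB.
    by rewrite -(ler_pM2r h0) mulVf ?gt_eqF//; apply: le_trans t1.
  exists (Some (t < 0, Ordinal aB)); rewrite /= prednK//; split.
  - move=> t0; have : a = 0%N by rewrite /a t0 normr0 mul0r truncn0.
    by move=> az; exfalso; move: a0; rewrite az.
  - by rewrite mulrCA normrMsign ger0_norm 1?mulrC// mulr_ge0// ltW.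
  have -> : t - h * ((-1) ^+ (t < 0)%R * a%:R) = (-1) ^+ (t < 0)%R * (`|t| - a%:R * h).
    rewrite mulrBr -realEsign ?num_real//; ring.
  rewrite normrMsign ger0_norm ?subr_ge0// lerBlDr.
  by rewrite -[X in X + _]mul1r -mulrDl addrC natr1 ltW.
have /choice [z hz] : forall i, exists v : code B, [/\ x ord0 i = 0 -> v = None,
    `|h * cval v| <= `|x ord0 i| & `|x ord0 i - h * cval v| <= h].
  by move=> i; apply: ex.
exists [ffun i => z i]; split.
- apply/fintype.subsetP => i; rewrite !inE ffunE; apply: contra => /eqP xi.
  by case: (hz i) => /(_ xi) ->.
- by move=> i; rewrite mxE ffunE; case: (hz i).
- by move=> i; rewrite !mxE ffunE; case: (hz i).
Qed.

(** Exponential weights turn the two constraints into a sum that factors over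
    the coordinates; [expR (- s)] is the price of a nonzero entry. With
    the rate [2 / p], the inequality [ln (a `^ p) <= a `^ p] bounds the weight of
    [a] by [a `^ (- 2)], which is summable. *)
Lemma card_sparse_codes B (k K s : R) : 0 <= s ->
  (#|[set z : {ffun 'I_n -> code B} |
      (#|csupp z|%:R <= k) && (\sum_i cabs (z i) `^ p <= K)]%SET|)%:R
  <= expR (s * k + 2 / p * K + 16 * expR (- s) * n%:R).
Proof.
move=> s0; rewrite card_set_sum.
pose w (v : code B) : R :=
  expR (- (s * (v != None)%:R)) * expR (- (2 / p * cabs v `^ p)).
have w_ge0 v : 0 <= w v by rewrite mulr_ge0 ?expR_ge0.
apply: (@le_trans _ _ (\sum_(z : {ffun 'I_n -> code B})
    expR (s * k + 2 / p * K) * \prod_i w (z i))).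
  apply: ler_sum => z _; rewrite big_split /= -!expR_sum -expRD -expRD.
  rewrite !sumrN -!mulr_sumr.
  have -> : \sum_i (z i != None)%:R = #|csupp z|%:R :> R.
    rewrite -sum1_card natr_sum [in RHS]big_mkcond /=.
    by apply: eq_bigr => i _; rewrite inE; case: (z i != None).
  case: andP => [[h1 h2]|_] /=; last by rewrite expR_ge0.
  rewrite -[leLHS]expR0 ler_expR.
  have p2 : 0 < 2 / p by rewrite divr_gt0.
  have := ler_wpM2l (ltW p2) h2.
  have := ler_wpM2l s0 h1; lra.
rewrite -mulr_sumr [leRHS]expRD ler_wpM2l ?expR_ge0//.
rewrite -(bigA_distr_bigA (fun _ => w)) /= prodr_const card_ord expRM_natr.
rewrite lerXn2r ?nnegrE ?expR_ge0 ?sumr_ge0//.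
apply: le_trans (expR_ge1Dx _).
have -> : \sum_v w v = 1 + \sum_(ca : bool * 'I_B) w (Some ca).
  rewrite (bigD1 None)//= {1}/w /= mulr0 powR0 ?gt_eqF// mulr0 oppr0 expR0 mulr1.
  congr (_ + _); rewrite (reindex_omap Some id)//=; last by case.
  by apply: eq_bigl => ca; rewrite eqxx.
rewrite lerD2l (eq_bigr (fun ca => w (Some (ca.1, ca.2)))) => [|[]//].
rewrite -(pair_bigA _ (fun c a => w (Some (c, a)))) /= big_bool /= -mulr2n.
have : \sum_(a < B) w (Some (true, a)) <= 8 * expR (- s).
  rewrite [leRHS]mulrC.
  apply: le_trans (ler_wpM2l (expR_ge0 _) (sum_inv_sqr_le8 B)).
  rewrite mulr_sumr; apply: ler_sum => a _; rewrite /w /= mulr1.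
  rewrite ler_wpM2l ?expR_ge0// [leRHS]powR_expR// ler_expR.
  have := @ln_sublinear R (a.+1%:R `^ p) (powR_gt0 _ (ltr0Sn _ _)).
  rewrite ln_powR => /ltW /(ler_wpM2l (ltW (divr_gt0 (ltr0n _ 2) p0))).
  by rewrite mulrA divfK ?gt_eqF// mulNr lerN2.
have -> : \sum_(a < B) w (Some (false, a)) = \sum_(a < B) w (Some (true, a)) by [].
rewrite mulr2n; lra.
Qed.

Section NetToAll.
Variables (r k theta rho C : R) (F : 'rV[R]_n -> R) (B : nat).
Hypotheses (r0 : 0 < r) (k0 : 0 < k) (C0 : 0 < C) (t0 : 0 < theta).
Hypotheses (p2 : p < 2) (tp : theta `^ p <= 1 / 8).
Hypotheses (tr : theta `^ r <= 1 / 2) (trC : 2 * C * theta `^ r <= rho / 2).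
Hypothesis F_sub : forall x y, F (x + y) <= F x + F y.
Hypothesis F_scale : forall a x, F (a *: x) = `|a| `^ r * F x.
Let h := theta * k `^ (- p^-1).
Hypothesis hB : h^-1 <= B%:R.
Hypothesis F_net : forall z : {ffun 'I_n -> code B}, #|csupp z|%:R <= k ->
  psum p (grid_point h z) <= 1 ->
  F (grid_point h z) <= C /\
  (1 / 8 <= psum p (grid_point h z) -> rho <= F (grid_point h z)).

Let F0 : F 0 = 0.
Proof. by rewrite -(scale0r (0 : 'rV[R]_n)) F_scale normr0 powR0 ?mul0r// gt_eqF. Qed.

Let F_opp x : F (- x) = F x.
Proof. by rewrite -scaleN1r F_scale normrN1 powR1 mul1r. Qed.

Let F_ge0 x : 0 <= F x.
Proof. by have := F_sub x (- x); rewrite subrr F0 F_opp; lra. Qed.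

Let F_bounded x : (forall i, `|x ord0 i| <= 1) -> F x <= \sum_i F (delta_mx ord0 i).
Proof.
move=> x1; rewrite {1}(row_sum_delta x).
apply: (@le_trans _ _ (\sum_i F (x ord0 i *: delta_mx ord0 i))).
  elim/big_ind2 : _ => [|x1' x2' y1 y2 h1 h2|//]; first by rewrite F0.
  by apply: le_trans (F_sub _ _) _; apply: lerD.
apply: ler_sum => i _; rewrite F_scale ler_piMl//.
have <- : 1 `^ r = 1 :> R by rewrite powR1.
by apply: ge0_ler_powR; rewrite ?nnegrE ?(ltW r0).
Qed.

Let h0 : 0 < h. Proof. by rewrite mulr_gt0 ?powR_gt0. Qed.

(** The grid step is chosen so that rounding the at most [k] nonzero entries
   costs at most [theta] in total. *)
Let h_pow : k * h `^ p = theta `^ p.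
Proof.
rewrite powRM ?powR_ge0 ?(ltW t0)// -powRrM mulNr mulVf ?gt_eqF//.
by rewrite powR_inv1 ?(ltW k0)// mulrCA divff ?mulr1// gt_eqF.
Qed.

(** The lower bound is available at the grid point [y], since [y] is not too
    short: [|u + v| <= 2 max(|u|, |v|)] and [2 `^ p <= 4] give
    [1 <= 4 (psum p y + theta `^ p)], hence [psum p y >= 1 / 8]. *)
Let approx x : sparse k x -> psum p x = 1 -> exists z : {ffun 'I_n -> code B},
  [/\ F (grid_point h z) <= C, rho <= F (grid_point h z),
      sparse k (x - grid_point h z) &
      psum p (x - grid_point h z) <= theta `^ p].
Proof.
move=> xk x1.
have [z [zs zx xz]] := round_to_grid h0 hB (fun i => psum1_le1 i x1).
have zk : #|csupp z|%:R <= k.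
  by apply: le_trans xk; rewrite ler_nat subset_leq_card.
set y := grid_point h z in zx xz *.
have powp s t : 0 <= s -> s <= t -> s `^ p <= t `^ p.
  move=> s0 st; apply: ge0_ler_powR; rewrite ?nnegrE ?(ltW p0)//.
  exact: le_trans st.
have dsub : (supp (x - y) \subset supp x)%SET.
  apply/fintype.subsetP => i; rewrite !inE; apply: contra => /eqP xi.
  have := zx i; rewrite xi normr0 normr_le0 => /eqP yi.
  by rewrite mxE xi add0r mxE yi oppr0.
have dsmall : psum p (x - y) <= theta `^ p.
  rewrite -h_pow /psum (bigID (mem (supp x)))/= [X in _ + X]big1 ?addr0; last first.
    move=> i ix; have : i \notin supp (x - y).
      by apply: contra ix; apply/fintype.subsetP.
    by rewrite inE negbK => /eqP ->; rewrite normr0 powR0// gt_eqF.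
  apply: (@le_trans _ _ (\sum_(i in supp x) h `^ p)).
    by apply: ler_sum => i _; exact: powp.
  rewrite sumr_const -[leLHS]mulr_natl ler_wpM2r ?powR_ge0//.
have y1 : psum p y <= 1.
  by rewrite -x1; apply: ler_sum => i _; exact: powp.
have y8 : 1 / 8 <= psum p y.
  have : psum p x <= 4 * (psum p y + psum p (x - y)).
    rewrite mulrDr !mulr_sumr -big_split /=; apply: ler_sum => i _.
    set a := `|y ord0 i|; set b := `|(x - y) ord0 i|.
    have a0 : 0 <= a by exact: normr_ge0.
    have b0 : 0 <= b by exact: normr_ge0.
    have xab : `|x ord0 i| <= 2 * Num.max a b.
      have -> : x ord0 i = y ord0 i + (x - y) ord0 i by rewrite !mxE; ring.
      apply: le_trans (ler_normD _ _) _; rewrite -/a -/b.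
      by rewrite mulr_natl mulr2n lerD// le_max lexx ?orbT.
    apply: le_trans (powp _ _ (normr_ge0 _) xab) _.
    rewrite powRM ?le_max ?a0//.
    have two : 2 `^ p <= 4.
      have -> : 4 = 2 `^ 2 :> R by rewrite powR_mulrn//; lra.
      by apply: ler_powR; [rewrite ler1n|exact: ltW].
    apply: le_trans (ler_wpM2r (powR_ge0 _ _) two) _.
    rewrite -mulrDr ler_wpM2l//.
    by case: (leP a b) => _; rewrite ?lerDl ?lerDr powR_ge0.
  rewrite x1; move: tp dsmall; lra.
have [yC yr] := F_net zk y1; exists z; split => //; first exact: yr.
exact: sparse_sub dsub xk.
Qed.

Let F_remainder x S : sparse k x -> psum p x <= theta `^ p -> 0 <= S ->
  (forall u, sparse k u -> psum p u = 1 -> F u <= S) -> F x <= theta `^ r * S.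
Proof.
move=> xk xp S0 hS; have [->|x0] := eqVneq x 0; first by rewrite F0 mulr_ge0 ?powR_ge0.
have [u [xu u1 uk]] := psum_normalize xk x0.
have td : psum p x `^ p^-1 <= theta.
  have -> : theta = (theta `^ p) `^ p^-1.
    by rewrite -powRrM divff ?gt_eqF// powRr1 ?ltW.
  by apply: ge0_ler_powR; rewrite ?nnegrE ?powR_ge0 ?psum_ge0// invr_ge0 ltW.
rewrite xu F_scale ger0_norm ?powR_ge0//.
apply: ler_pM; rewrite ?powR_ge0//; last exact: hS.
by apply: ge0_ler_powR; rewrite ?nnegrE ?powR_ge0 ?(ltW r0) ?(ltW t0).
Qed.

(** The supremum [S] of [F] over the sparse unit vectors satisfies
    [S <= C + theta `^ r * S <= C + S / 2], and it is finite by
    [F_bounded]. *)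
Let unit_upper x : sparse k x -> psum p x = 1 -> F x <= 2 * C.
Proof.
move=> xk x1.
pose E := [set F u | u in [set u : 'rV[R]_n | sparse k u /\ psum p u = 1]].
have Eub : ubound E (\sum_i F (delta_mx ord0 i)).
  by move=> _ [u [_ u1] <-]; apply: F_bounded => i; apply: psum1_le1.
have hasE : has_sup E by split; [exists (F x); exists x|exists (\sum_i F (delta_mx ord0 i))].
have memE u : sparse k u -> psum p u = 1 -> F u <= sup E.
  by move=> uk u1; apply: ub_le_sup => //; [case: hasE|exists u].
have sup0 : 0 <= sup E by apply: le_trans (memE x xk x1).
suff : sup E <= C + theta `^ r * sup E.
  have := ler_wpM2r sup0 tr; have := memE x xk x1; lra.
apply: ge_sup; first by case: hasE.
move=> _ [u [uk u1] <-].
have [z [zC _ dk dp]] := approx uk u1; set y := grid_point h z in zC dk dp.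
have -> : u = y + (u - y) by rewrite addrC subrK.
apply: le_trans (F_sub _ _) (lerD zC _); exact: F_remainder.
Qed.

(** The lower bound uses the upper one: if the grid point [y] is the rounding of
    a unit vector [u] then [F y <= F u + F (u - y)], where [F y >= rho] and the
    last term is at most [rho / 2]. *)
Lemma sparse_bounds_of_grid x : sparse k x ->
  rho / 2 * psum p x `^ (r / p) <= F x <= 2 * C * psum p x `^ (r / p).
Proof.
have scaled u t : sparse k u -> psum p u = 1 -> 0 < t ->
    rho / 2 * t `^ r <= F (t *: u) <= 2 * C * t `^ r.
  move=> uk u1 tt; rewrite F_scale gtr0_norm// ![_ * t `^ r]mulrC.
  apply/andP; split; last by rewrite ler_wpM2l ?powR_ge0// unit_upper.
  rewrite ler_wpM2l ?powR_ge0//.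
  have [z [_ zr dk dp]] := approx uk u1; set y := grid_point h z in zr dk dp.
  have : F y <= F u + F (u - y).
    have {1}-> : y = u + - (u - y) by rewrite opprB addrC subrK.
    by apply: le_trans (F_sub _ _) _; rewrite F_opp.
  suff : F (u - y) <= 2 * C * theta `^ r by move: zr trC; lra.
  by rewrite mulrC; apply: F_remainder => //; rewrite mulr_ge0// ltW.
have [->|x0] := eqVneq x 0 => xk.
  have /eqP -> : psum p 0 == 0 by rewrite psum_eq0.
  by rewrite F0 powR0 ?mulr0 ?lexx// mulf_eq0 negb_or invr_eq0 !gt_eqF.
have [u [xu u1 uk]] := psum_normalize xk x0.
have t_gt0 : 0 < psum p x `^ p^-1.
  by rewrite powR_gt0// lt_neqAle eq_sym psum_eq0 x0 psum_ge0.
have -> : F x = F (psum p x `^ p^-1 *: u) by rewrite -xu.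
by rewrite [r / p]mulrC powRrM; exact: scaled.
Qed.

End NetToAll.

End Grid.

(** * The truncated operator at one vector, and at all sparse vectors *)

Section FixedVector.
Context {R : realType}.
Variables (p r : R) (m n N : nat).
Hypotheses (r0 : 0 < r) (rp : r < p) (p2 : p < 2) (r1 : r <= 1) (m0 : (0 < m)%N).

Let p0 : 0 < p. Proof. exact: lt_trans rp. Qed.
Let mR : 0 < m%:R :> R. Proof. by rewrite ltr0n. Qed.

Local Notation I := ('I_n * 'I_N)%type.
Local Notation signs := {ffun I -> bool}.
Local Notation bins := {ffun I -> 'I_m}.

(** The coefficients of the truncated operator, scaled by [m `^ p^-1] so that the
    threshold between large and small ones is 1. *)
Definition coef (x : 'rV[R]_n) (ij : I) : R :=
  m%:R `^ p^-1 * x ord0 ij.1 * ij.2.+1%:R `^ (- p^-1).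

(** The [r]-th power of the normalized norm of the truncated image, as shown by
    [lnorm_S_part]. *)
Definition Phi (ek : signs * bins) (x : 'rV[R]_n) : R :=
  m%:R^-1 * \sum_k `|throw (coef x) ek.1 ek.2 k| `^ r.

Lemma throwD (a b : I -> R) (e : signs) (kap : bins) k :
  throw (fun i => a i + b i) e kap k = throw a e kap k + throw b e kap k.
Proof. by rewrite /throw -big_split /=; apply: eq_bigr => i _; rewrite mulrDl. Qed.

Lemma eq_throw (a b : I -> R) (e : signs) (kap : bins) k :
  a =1 b -> throw a e kap k = throw b e kap k.
Proof. by move=> ab; apply: eq_bigr => i _; rewrite ab. Qed.

Lemma Phi_sub ek x y : Phi ek (x + y) <= Phi ek x + Phi ek y.
Proof.
rewrite /Phi -mulrDr ler_wpM2l ?invr_ge0 ?(ltW mR)// -big_split /=.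
apply: ler_sum => k _; rewrite (@eq_throw _ (fun ij => coef x ij + coef y ij)).
  by rewrite throwD normr_powR_subadd.
by move=> ij; rewrite /coef mxE; ring.
Qed.

Lemma Phi_scale ek a x : Phi ek (a *: x) = `|a| `^ r * Phi ek x.
Proof.
rewrite /Phi mulrCA; congr (_ * _); rewrite mulr_sumr; apply: eq_bigr => k _.
rewrite -powRM// -normrM; congr (`|_| `^ _).
rewrite /throw mulr_sumr; apply: eq_bigr => ij _; rewrite /coef mxE; ring.
Qed.

Let M (x : 'rV[R]_n) (i : 'I_n) : R := m%:R * `|x ord0 i| `^ p.

Let M_ge0 x i : 0 <= M x i.
Proof. by rewrite mulr_ge0 ?powR_ge0// ltW. Qed.

Let sum_M x : \sum_i M x i = m%:R * psum p x.
Proof. by rewrite mulr_sumr. Qed.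

Let coef_norm x ij : `|coef x ij| = M x ij.1 `^ p^-1 * ij.2.+1%:R `^ (- p^-1).
Proof.
rewrite /coef !normrM (ger0_norm (powR_ge0 _ _)) [X in _ * X]ger0_norm ?powR_ge0//.
congr (_ * _); rewrite powRM ?(ltW mR) ?powR_ge0//.
by rewrite -powRrM divff ?gt_eqF// powRr1.
Qed.

Let coef_norm_pow x ij s : `|coef x ij| `^ s =
  M x ij.1 `^ (s / p) * ij.2.+1%:R `^ (- (s / p)).
Proof.
rewrite coef_norm powRM ?powR_ge0// -!powRrM.
by congr (_ `^ _ * _ `^ _); [rewrite mulrC|rewrite mulNr mulrC].
Qed.

Let big (x : 'rV[R]_n) (ij : I) : bool := ij.2.+1%:R <= M x ij.1.

(** The constants of [sum_powR_head] and [sum_powR_tail] for the exponents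
    [r / p] and [2 / p]. *)
Definition head_const : R := 4 / (1 - r / p).
Definition tail_const : R := 2 `^ (2 / p) / (2 / p - 1).

Let rp1 : r / p < 1. Proof. by rewrite ltr_pdivrMr ?mul1r. Qed.
Let tp1 : 1 < 2 / p. Proof. by rewrite ltr_pdivlMr ?mul1r. Qed.

Lemma head_const_ge0 : 0 <= head_const.
Proof. by rewrite divr_ge0// subr_ge0 ltW. Qed.

Lemma tail_const_ge0 : 0 <= tail_const.
Proof. by rewrite divr_ge0 ?powR_ge0// subr_ge0 ltW. Qed.

Let sum_big x : \sum_(ij | big x ij) `|coef x ij| `^ r
  <= head_const * (m%:R * psum p x).
Proof.
rewrite -sum_M mulr_sumr.
rewrite (eq_bigl (fun ij : I => xpredT ij.1 && (ij.2.+1%:R <= M x ij.1)))//.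
rewrite (eq_bigr (fun ij : I => `|coef x (ij.1, ij.2)| `^ r)) => [|[]//].
rewrite -(pair_big_dep xpredT (fun i (j : 'I_N) => j.+1%:R <= M x i)
  (fun i j => `|coef x (i, j)| `^ r)) /=.
apply: ler_sum => i _; under eq_bigr do rewrite coef_norm_pow /=.
rewrite -mulr_sumr; have [Mi|Mi] := ltrP 0 (M x i); last first.
  have -> : M x i = 0 by apply/eqP; rewrite eq_le Mi M_ge0.
  by rewrite powR0 ?mul0r ?mulr0// mulf_neq0 ?invr_eq0 ?gt_eqF.
have rp0 : 0 < r / p by rewrite divr_gt0.
apply: le_trans (ler_wpM2l (powR_ge0 _ _) (sum_powR_head N rp0 rp1 Mi)) _.
rewrite [leLHS]mulrCA -powRDp// [r / p + _]addrC subrK powRr1 ?(ltW Mi)//.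
Qed.

Let sum_small x : \sum_ij (if big x ij then 0 else coef x ij) ^+ 2
  <= tail_const * (m%:R * psum p x).
Proof.
rewrite (eq_bigr (fun ij => if ~~ big x ij then `|coef x ij| `^ 2 else 0)); last first.
  by move=> ij _; case: (big x ij) => /=; rewrite ?expr0n// powR_mulrn// real_normK ?num_real.
rewrite -big_mkcond -sum_M mulr_sumr.
rewrite (eq_bigl (fun ij : I => xpredT ij.1 && (M x ij.1 < ij.2.+1%:R))); last first.
  by move=> ij; rewrite /big -ltNge.
rewrite (eq_bigr (fun ij : I => `|coef x (ij.1, ij.2)| `^ 2)) => [|[]//].
rewrite -(pair_big_dep xpredT (fun i (j : 'I_N) => M x i < j.+1%:R)
  (fun i j => `|coef x (i, j)| `^ 2)) /=.
apply: ler_sum => i _; under eq_bigr do rewrite coef_norm_pow /=.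
rewrite -mulr_sumr; have [Mi|Mi] := ltrP 0 (M x i); last first.
  have -> : M x i = 0 by apply/eqP; rewrite eq_le Mi M_ge0.
  by rewrite powR0 ?mul0r ?mulr0// mulf_neq0 ?invr_eq0 ?gt_eqF.
apply: le_trans (ler_wpM2l (powR_ge0 _ _) (sum_powR_tail N tp1 Mi)) _.
rewrite [leLHS]mulrCA -powRDp// [2 / p + (1 - _)]addrC subrK powRr1 ?(ltW Mi)//.
Qed.

(** Deterministic: the [r]-th power of the quasi-norm is subadditive. *)
Lemma throw_powR_sum (b : I -> R) (e : signs) (kap : bins) :
  \sum_k `|throw b e kap k| `^ r <= \sum_i `|b i| `^ r.
Proof.
rewrite [leRHS](partition_big kap xpredT)//=; apply: ler_sum => k _.
rewrite /throw; elim/big_ind2 : _ => [|x1 x2 y1 y2 h1 h2|i _].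
- by rewrite normr0 powR0// gt_eqF.
- by apply: le_trans (normr_powR_subadd _ _ r0 r1) (lerD h1 h2).
by rewrite normrM normr_sign mulr1.
Qed.

Definition upper_const : R := head_const + 3 * tail_const + 3.

(** The large coefficients contribute at most [head_const] to [Phi],
    deterministically; for the small ones, [|w| `^ r <= 1 + |w|] reduces the
    claim to the l_1 norm. The final 3 in [upper_const] is 1 for this
    inequality, and 2 so that [expR (- 2 m)] absorbs the factor [2 ^ m] of the
    union bound and still leaves [expR (- m)]. *)
Lemma card_Phi_large x : psum p x <= 1 ->
  (#|[set ek : signs * bins | upper_const < Phi ek x]%SET|)%:R
   <= expR (- m%:R) * (2 ^+ #|{: I}| * m%:R ^+ #|{: I}|) :> R.
Proof.
move=> x1; pose bs ij := if big x ij then 0 else coef x ij.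
pose bl ij := if big x ij then coef x ij else 0.
have V : \sum_i bs i ^+ 2 <= tail_const * m%:R.
  apply: le_trans (sum_small x) _; rewrite ler_wpM2l ?tail_const_ge0//.
  by rewrite ler_piMr// ltW.
have L : \sum_i `|bl i| `^ r <= head_const * m%:R.
  rewrite (eq_bigr (fun ij => if big x ij then `|coef x ij| `^ r else 0)).
    rewrite -big_mkcond; apply: le_trans (sum_big x) _.
    by rewrite ler_wpM2l ?head_const_ge0// ler_piMr// ltW.
  by move=> ij _; rewrite /bl; case: ifP => // _; rewrite normr0 powR0// gt_eqF.
pose t : R := (2 + 3 * tail_const) * m%:R.
apply: (@le_trans _ _ (#|[set ek : signs * bins | t < \sum_k `|throw bs ek.1 ek.2 k|]%SET|)%:R).
  rewrite ler_nat; apply: subset_leq_card; apply/fintype.subsetP => ek; rewrite !inE.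
  rewrite /Phi mulrC ltr_pdivlMr// => h.
  have : \sum_k `|throw (coef x) ek.1 ek.2 k| `^ r <=
      \sum_k `|throw bl ek.1 ek.2 k| `^ r + (m%:R + \sum_k `|throw bs ek.1 ek.2 k|).
    have -> : m%:R = \sum_(k < m) 1 :> R by rewrite sumr_const card_ord.
    rewrite -!big_split /=; apply: ler_sum => k _.
    rewrite (@eq_throw _ (fun ij => bl ij + bs ij)); last first.
      by move=> ij; rewrite /bl /bs; case: ifP; rewrite ?addr0 ?add0r.
    rewrite throwD; apply: le_trans (normr_powR_subadd _ _ r0 r1) _.
    rewrite lerD2l; have [h1|h1] := lerP 1 `|throw bs ek.1 ek.2 k|.
      by apply: le_trans (ler1_powR h1 r1) _; rewrite lerDr.
    have le1 : `|throw bs ek.1 ek.2 k| `^ r <= 1.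
      have <- : 1 `^ r = 1 :> R by rewrite powR1.
      by apply: ge0_ler_powR; rewrite ?nnegrE ?(ltW r0) ?(ltW h1).
    by apply: le_trans le1 _; rewrite lerDl.
  have := throw_powR_sum bl ek.1 ek.2; move: h L; rewrite /t /upper_const; nra.
apply: le_trans (card_throw_l1_tail_pair _ _ _) _.
rewrite ler_wpM2r ?mulr_ge0 ?exprn_ge0 ?(ltW mR)//.
have two : 2 ^+ m <= expR m%:R :> R.
  rewrite -[m%:R]mul1r expRM_natr lerXn2r ?nnegrE ?expR_ge0//.
  by apply: le_trans (expR_ge1Dx 1); lra.
apply: le_trans (ler_wpM2r (expR_ge0 _) two) _.
rewrite -expRD ler_expR /t; lra.
Qed.

(** There are [floor (M i)] coefficients of absolute value at least 1 in row [i],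
    provided that [N >= m >= M i]. Summing [M i - 1] over the support gives at
    least [m / 8 - m / 16]. *)
Lemma card_Phi_small x : (m <= N)%N -> psum p x <= 1 -> 1 / 8 <= psum p x ->
  #|supp x|%:R <= m%:R / 16 :> R ->
  (#|[set ek : signs * bins | Phi ek x < tiny]%SET|)%:R
   <= 2 * expR (- (2 * tiny * m%:R)) * (2 ^+ #|{: I}| * m%:R ^+ #|{: I}|) :> R.
Proof.
move=> mN x1 x8 xs; pose J := [set ij | big x ij]%SET.
have coefJ ij : ij \in J -> 1 <= `|coef x ij|.
  rewrite inE /big coef_norm powRN => h.
  rewrite ler_pdivlMr ?powR_gt0// mul1r.
  by apply: ge0_ler_powR; rewrite ?nnegrE ?M_ge0// invr_ge0 ltW.
have Mm i : M x i <= m%:R.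
  rewrite ler_piMr ?(ltW mR)//; apply: le_trans x1.
  by rewrite /psum (bigD1 i)//= lerDl sumr_ge0// => j _; rewrite powR_ge0.
have cardJ : m%:R / 16 <= #|J|%:R :> R.
  rewrite -sum1_card natr_sum (eq_bigl (fun ij : I => xpredT ij.1 && (ij.2.+1%:R <= M x ij.1))); last first.
    by move=> ij; rewrite inE.
  rewrite -(pair_big_dep xpredT (fun i (j : 'I_N) => j.+1%:R <= M x i) (fun _ _ => 1)) /=.
  have row i : (if i \in supp x then M x i - 1 else 0) <=
      \sum_(j < N | j.+1%:R <= M x i) 1 :> R.
    case: ifP => [ix|_]; last by rewrite sumr_ge0.
    have /truncn_itv/andP[t1 t2] := M_ge0 x i.
    set T := Num.truncn (M x i) in t1 t2.
    have TN : (T <= N)%N.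
      rewrite (leq_trans _ mN)// -(ler_nat R); apply: le_trans t1 (Mm i).
    rewrite (eq_bigl (fun j : 'I_N => (j < T)%N)); last first.
      move=> j; apply/idP/idP => [jM|jT].
        by rewrite -ltnS -(ltr_nat R); apply: le_lt_trans t2.
      by apply: le_trans t1; rewrite ler_nat.
    rewrite (big_ord_narrow TN) sumr_const card_ord; move: t2; rewrite -natr1; lra.
  apply: le_trans (ler_sum _ (fun i _ => row i)).
  rewrite -big_mkcond big_split /= sumrN sumr_const.
  have -> : \sum_(i in supp x) M x i = m%:R * psum p x.
    rewrite -sum_M [RHS](bigID (mem (supp x)))/= [X in _ + X]big1 ?addr0//.
    by move=> i; rewrite inE negbK /M => /eqP ->; rewrite normr0 powR0 ?mulr0// gt_eqF.
  have := ler_wpM2l (ltW mR) x8; move: xs; lra.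
apply: le_trans (card_throw_few_large m0 cardJ coefJ).
rewrite ler_nat; apply: subset_leq_card; apply/fintype.subsetP => ek; rewrite !inE.
rewrite /Phi mulrC ltr_pdivrMr// => h; apply: le_trans (_ : _ <= tiny * m%:R) _; last first.
  by rewrite mulrC.
apply/ltW; apply: le_lt_trans h.
rewrite -sum1_card natr_sum big_mkcond /=; apply: ler_sum => k _.
rewrite inE; case: ifP => [h|_]; last exact: powR_ge0.
rewrite -[leLHS](powRr0 `|throw (coef x) ek.1 ek.2 k|).
exact: ler_powR h _ _ (ltW r0).
Qed.

(** Chosen so that [2 * upper_const * mesh `^ r = tiny / 2], so that
    rounding costs at most half of the lower bound [tiny]. *)
Definition mesh : R := (tiny / (4 * upper_const)) `^ r^-1.

Lemma upper_const_ge3 : 3 <= upper_const.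
Proof. by rewrite /upper_const; have := head_const_ge0; have := tail_const_ge0; lra. Qed.

Let mesh_base : 0 < tiny / (4 * upper_const) :> R.
Proof. by apply: divr_gt0; [exact: tiny_gt0|have := upper_const_ge3; lra]. Qed.

Let mesh0 : 0 < mesh. Proof. exact: powR_gt0. Qed.

Let mesh_r : mesh `^ r = tiny / (4 * upper_const).
Proof. by rewrite /mesh -powRrM mulVf ?gt_eqF// powRr1// ltW. Qed.

Let mesh_r8 : mesh `^ r <= 1 / 8.
Proof.
have u3 := upper_const_ge3; rewrite mesh_r ler_pdivrMr; last by lra.
have := @tiny_le2 R; lra.
Qed.

Let mesh_p : mesh `^ p <= 1 / 8.
Proof.
apply: le_trans mesh_r8; apply: ger_powR; last exact: ltW.
rewrite mesh0 /= leNgt; apply/negP => h; move: mesh_r8.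
have : 1 < mesh `^ r.
  by apply: le_lt_trans (gt0_ltr_powR r0 _ _ h); rewrite ?nnegrE ?powR1// ltW.
lra.
Qed.

(** The logarithm of the number of grid points is at most
    [delta n (ln (1 / delta) + rate_const)]. *)
Definition rate_const : R := 2 / p * mesh `^ (- p) + 16.

Definition all_sparse_bounds (k : R) (ek : signs * bins) : Prop :=
  forall x : 'rV[R]_n, sparse k x ->
    tiny / 2 * psum p x `^ (r / p) <= Phi ek x
      <= 2 * upper_const * psum p x `^ (r / p).

(** If the bounds fail at some sparse vector then one of the fixed-vector bounds
    fails at a point of the grid. The weights of [card_sparse_codes] are taken
    with [s = ln (1 / delta)], which turns [16 expR (- s) n] into
    [16 delta n]. *)
Lemma card_not_all_sparse_bounds (delta : R) : (m <= N)%N ->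
  0 < delta -> delta <= 1 -> (0 < n)%N -> delta * n%:R <= m%:R / 16 ->
  delta * n%:R * (ln delta^-1 + rate_const) <= tiny * m%:R ->
  (#|[set ek : signs * bins | ~~ `[< all_sparse_bounds (delta * n%:R) ek >]]%SET|)%:R
   <= 3 * expR (- (tiny * m%:R)) * (2 ^+ #|{: I}| * m%:R ^+ #|{: I}|) :> R.
Proof.
move=> mN d0 d1 n0; set k := delta * n%:R => km kr.
have k0 : 0 < k by rewrite mulr_gt0// ltr0n.
pose h := mesh * k `^ (- p^-1).
have h0 : 0 < h by rewrite mulr_gt0 ?powR_gt0.
pose B := (Num.truncn h^-1).+1.
have hB : h^-1 <= B%:R.
  have /truncn_itv/andP[_ /ltW//] : 0 <= h^-1 by rewrite invr_ge0 ltW.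
pose K := mesh `^ (- p) * k.
pose net : pred {ffun 'I_n -> code B} := fun z =>
  (#|csupp z|%:R <= k) && (\sum_i cabs (z i) `^ p <= K).
pose viol (z : {ffun 'I_n -> code B}) : pred (signs * bins) := fun ek =>
  (upper_const < Phi ek (grid_point h z)) ||
  ((1 / 8 <= psum p (grid_point h z)) && (Phi ek (grid_point h z) < tiny)).
have hp : h `^ p * K = 1.
  rewrite /h /K powRM ?powR_ge0 ?(ltW mesh0)// -powRrM mulNr mulVf ?gt_eqF//.
  rewrite powR_inv1 ?(ltW k0)// powRN mulrACA mulfV ?mulVf ?mulr1// gt_eqF// powR_gt0//.
have netP z : psum p (grid_point h z) <= 1 <-> \sum_i cabs (z i) `^ p <= K.
  rewrite psum_grid_point ?(ltW h0)// -hp ler_pM2l ?powR_gt0//.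
have net_supp z : net z -> #|supp (grid_point h z)|%:R <= k.
  move=> /andP[zk _]; apply: le_trans zk; rewrite ler_nat; apply: subset_leq_card.
  apply/fintype.subsetP => i; rewrite !inE mxE; apply: contra => /eqP ->.
  by rewrite mulr0.
apply: le_trans (card_le_cover (Q := net) (B := viol) _) _.
  move=> ek bad; apply/exists2P; apply: contrapT => noz; move/negP: bad; apply.
  apply/asboolP => x xk.
  have := @sparse_bounds_of_grid R p n p0 r k mesh tiny upper_const (Phi ek) B
    r0 k0 _ mesh0 p2 mesh_p _ _ (Phi_sub ek) (Phi_scale ek) hB _ x xk.
  have u3 := upper_const_ge3.
  apply; [lra|by have := mesh_r8; lra| |].
    rewrite mesh_r; set c := tiny; rewrite le_eqVlt; apply/orP; left.
    by apply/eqP; field; rewrite gt_eqF//; lra.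
  move=> z zk /netP zK; split.
    rewrite leNgt; apply/negP => bad; apply: noz; exists z.
    by rewrite /net zk zK; split => //; rewrite /viol bad.
  move=> z8; rewrite leNgt; apply/negP => bad; apply: noz; exists z.
  by rewrite /net zk zK; split => //; rewrite /viol bad z8 orbT.
set W := 2 ^+ _ * _.
have W0 : 0 <= W by rewrite mulr_ge0 ?exprn_ge0// ltW.
apply: (@le_trans _ _ (\sum_(z | net z) 3 * expR (- (2 * tiny * m%:R)) * W)).
  apply: ler_sum => z nz; have /andP[zk zK] := nz; move/netP: zK => zK.
  have Eb : expR (- m%:R) <= expR (- (2 * tiny * m%:R)) :> R.
    rewrite ler_expR lerN2 ler_piMl ?(ltW mR)//; have := @tiny_le2 R; lra.
  pose vs (c : bool) : pred (signs * bins) := fun ek =>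
    if c then upper_const < Phi ek (grid_point h z) else
    (1 / 8 <= psum p (grid_point h z)) && (Phi ek (grid_point h z) < tiny).
  apply: le_trans (card_le_cover (Q := predT) (B := vs) _) _.
    by move=> ek /orP[h1|h1]; [exists true|exists false].
  rewrite big_bool.
  have h1 : (#|[set ek | vs true ek]%SET|)%:R <= expR (- (2 * tiny * m%:R)) * W.
    apply: le_trans (card_Phi_large zK) _.
    by rewrite ler_wpM2r.
  have h2 : (#|[set ek | vs false ek]%SET|)%:R <= 2 * expR (- (2 * tiny * m%:R)) * W.
    have [z8|z8] := lerP (1 / 8) (psum p (grid_point h z)); last first.
      rewrite eq_card0 ?mulr_ge0 ?expR_ge0// => ek.
      by rewrite !inE /vs leNgt z8.
    apply: le_trans (card_Phi_small mN zK z8 _).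
      rewrite ler_nat; apply: subset_leq_card; apply/fintype.subsetP => ek.
      by rewrite !inE => /andP[].
    by apply: le_trans km; apply: net_supp.
  apply: le_trans (lerD h1 h2) _; lra.
rewrite sumr_const -[leLHS]mulr_natl mulrA ler_wpM2r//.
have ld0 : 0 <= ln delta^-1 by rewrite ln_ge0// invf_ge1.
have := @card_sparse_codes R p n p0 B k K (ln delta^-1) ld0.
rewrite cardsE lnV ?posrE// opprK lnK ?posrE// => hn.
rewrite mulrCA ler_wpM2l//.
apply: le_trans (ler_wpM2r (expR_ge0 _) hn) _; rewrite -expRD ler_expR.
move: kr; rewrite lnV ?posrE// /rate_const /K -/k.
have -> : 16 * delta * n%:R = 16 * k by rewrite /k mulrA.
set u := mesh `^ (- p); lra.
Qed.

End FixedVector.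

(** * Limits of norms, and summation by parts *)

Section Convergence.
Context {R : realType}.

Lemma cvg_powR_nonneg (u : nat -> R) (l s : R) : 0 < s -> (forall j, 0 <= u j) ->
  u @ \oo --> l -> (fun j => u j `^ s) @ \oo --> l `^ s.
Proof.
move=> s0 u0 ul.
have l0 : 0 <= l.
  by apply: cvgr_to_ge ul _; apply: nearW.
move: l0; rewrite le_eqVlt => /orP[/eqP l0|l0]; last first.
  have cs : {for l, continuous (fun t : R => t `^ s)}.
    apply: differentiable_continuous; apply/derivable1_diffP/derivable_powR.
    by rewrite in_itv /= l0.
  exact: (cvg_comp _ _ ul cs).
rewrite -l0 powR0 ?gt_eqF//; rewrite -l0 in ul.
apply/cvgrPdist_lt => e e0.
have e1 : 0 < e `^ s^-1 by rewrite powR_gt0.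
move/cvgrPdist_lt : ul => /(_ _ e1); apply: filterS => j.
rewrite !sub0r !normrN !ger0_norm ?powR_ge0// => ue.
have -> : e = (e `^ s^-1) `^ s by rewrite -powRrM mulVf ?gt_eqF// powRr1// ltW.
by apply: gt0_ltr_powR; rewrite ?nnegrE ?powR_ge0.
Qed.

Lemma cvg_lnorm N (s : R) (u : nat -> 'rV[R]_N) (l : 'rV[R]_N) : 0 < s ->
  (forall i, (fun j => u j ord0 i) @ \oo --> l ord0 i) ->
  (fun j => lnorm s (u j)) @ \oo --> lnorm s l.
Proof.
move=> s0 ul; apply: cvg_powR_nonneg; first by rewrite invr_gt0.
  by move=> j; apply: sumr_ge0 => i _; apply: powR_ge0.
apply: (@cvg_big _ _ +%R 0) => [|i _]; first exact: add_continuous.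
apply: cvg_powR_nonneg => //.
exact: cvg_norm.
Qed.

Lemma abel_sum (a X : nat -> R) J :
  \sum_(l < J) a l * X l = a J * (\sum_(l < J) X l)
    + \sum_(l < J) (a l - a l.+1) * \sum_(i < l.+1) X i.
Proof.
elim: J => [|J IH]; first by rewrite !big_ord0 mulr0 addr0.
rewrite [LHS]big_ord_recr /= IH [in RHS]big_ord_recr /=.
rewrite [X in _ = _ + X]big_ord_recr /= !big_ord_recr /=; ring.
Qed.

(** Summation by parts: [a j] decreases like [j `^ (- s)], with increments of
    order [j `^ (- s - 1)], so the boundary term tends to 0 and the remaining
    series converges absolutely, as [beta < s]. *)
Lemma cvg_series_abel (X : nat -> R) (s beta K : R) : 0 < s -> 0 < beta -> beta < s ->
  (forall j, `|\sum_(l < j) X l| <= K * j.+1%:R `^ beta) ->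
  cvgn (series (fun j => j.+1%:R `^ (- s) * X j)).
Proof.
move=> s0 b0 bs hX; pose T j := \sum_(l < j) X l.
pose a j : R := j.+1%:R `^ (- s).
have K0 : 0 <= K by have := hX 0%N; rewrite big_ord0 normr0 powR1 mulr1.
have -> : series (fun j => j.+1%:R `^ (- s) * X j) =
    (fun J => a J * T J) \+ series (fun l => (a l - a l.+1) * T l.+1).
  apply/funext => J; rewrite /series /= !big_mkord; exact: abel_sum.
have decay : (fun j => K * j.+1%:R `^ (beta - s)) @ \oo --> (0 : R).
  have -> : (fun j => K * j.+1%:R `^ (beta - s)) =
      (fun j => K * (harmonic j) `^ (s - beta) : R).
    apply/funext => j; rewrite /harmonic /= -[in RHS]powR_inv1 ?ler0n// -powRrM.
    by congr (_ * _ `^ _); ring.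
  rewrite -[X in _ --> X](mulr0 K); apply: cvgMr.
  rewrite -[X in _ --> X](@powR0 _ (s - beta)) ?gt_eqF ?subr_gt0//.
  apply: cvg_powR_nonneg; rewrite ?subr_gt0//.
    by move=> j; rewrite /harmonic /= invr_ge0.
  exact: cvg_harmonic.
apply: is_cvgD.
  apply: (@cvgP _ _ 0).
  apply: (@squeeze_cvgr _ _ _ _ (fun j => - (K * j.+1%:R `^ (beta - s)))
     (fun j => K * j.+1%:R `^ (beta - s))).
  - apply: nearW => j; rewrite -ler_norml normrM ger0_norm ?powR_ge0//.
    have -> : K * j.+1%:R `^ (beta - s) = j.+1%:R `^ (- s) * (K * j.+1%:R `^ beta).
      by rewrite mulrCA -powRDp ?ltr0n// addrC.
    by apply: ler_wpM2l; [exact: powR_ge0|exact: hX].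
  - by rewrite -oppr0; apply: cvgN.
  - by [].
apply: normed_cvg; rewrite /=.
pose v l : R := K * 2 `^ beta * s * l.+1%:R `^ (- (1 + (s - beta))).
apply: (@series_le_cvg _ _ v) => [l|l|l|].
- exact: normr_ge0.
- by rewrite !mulr_ge0 ?powR_ge0// ltW.
- have t0 : 0 < l.+1%:R :> R by rewrite ltr0n.
  have t1 : l.+2%:R = l.+1%:R + 1 :> R by rewrite natr1.
  have al : 0 <= a l - a l.+1 <= s * l.+1%:R `^ (- s - 1).
    rewrite subr_ge0 /a; apply/andP; split.
      rewrite !powRN lef_pV2 ?posrE ?powR_gt0//; apply: ge0_ler_powR;
      by rewrite ?nnegrE ?ler0n ?(ltW s0)// ler_nat.
    have e1 : l.+2%:R `^ (- s) = l.+1%:R `^ (- s) * (l.+2%:R / l.+1%:R) `^ (- s) :> R.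
      by rewrite -powRM ?divr_ge0// mulrC divfK ?gt_eqF.
    have e2 : 1 - s / l.+1%:R <= (l.+2%:R / l.+1%:R) `^ (- s) :> R.
      rewrite powR_expR ?divr_gt0//; apply: le_trans (expR_ge1Dx _).
      rewrite lerD2l mulNr lerN2 ler_wpM2l ?(ltW s0)//.
      have -> : l.+2%:R / l.+1%:R = 1 + l.+1%:R^-1 :> R.
        by rewrite t1 mulrDl divff ?gt_eqF// mul1r.
      by apply: le_ln1Dx; rewrite (@lt_trans _ _ 0) ?invr_gt0// ltrN10.
    rewrite powRDp// powR_inv1 ?ler0n// e1.
    have P := powR_gt0 (- s) t0.
    rewrite -subr_ge0 [X in 0 <= X](_ : _ = l.+1%:R `^ (- s) *
      ((l.+2%:R / l.+1%:R) `^ (- s) - (1 - s / l.+1%:R))); last by ring.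
    by rewrite mulr_ge0 ?subr_ge0// ltW.
  case/andP: al => al0 al1.
  rewrite /= normrM (ger0_norm al0) /v.
  have e3 : l.+2%:R `^ beta <= 2 `^ beta * l.+1%:R `^ beta :> R.
    rewrite -powRM//; apply: ge0_ler_powR; rewrite ?nnegrE ?ler0n ?mulr_ge0 ?(ltW b0)//.
    by rewrite t1; have : 1 <= l.+1%:R :> R; [rewrite ler1n|lra].
  have e4 := le_trans (hX l.+1) (ler_wpM2l K0 e3).
  apply: le_trans (ler_pM al0 (normr_ge0 _) al1 e4) _.
  have -> : - (1 + (s - beta)) = (- s - 1) + beta by ring.
  rewrite [in leRHS]powRDp// le_eqVlt; apply/orP; left; apply/eqP; ring.
apply: nondecreasing_is_cvgn.
  by apply: nondecreasing_series => l _; rewrite !mulr_ge0 ?powR_ge0// ltW.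
pose b := 1 + (s - beta).
have b1 : 1 < b by rewrite /b; lra.
exists (K * 2 `^ beta * s * (2 `^ b / (b - 1) * (1/2) `^ (1 - b))) => _ [J _ <-].
rewrite /series /= big_mkord -mulr_sumr ler_wpM2l//.
  by rewrite !mulr_ge0 ?powR_ge0// ltW.
have := @sum_powR_tail R b (1/2) J b1 ltac:(lra).
rewrite (eq_bigl xpredT)// => j.
by rewrite (@lt_le_trans _ _ 1)//; [lra|rewrite ler1n].
Qed.

End Convergence.

(** * From counting to probability *)

Section FiniteTruncation.
Context {d : measure_display} {Omega : measurableType d} {R : realType}.
Variables (P : probability Omega R) (n m : nat).
Variable (Y : 'I_n -> nat -> Omega -> 'rV[R]_m).
Hypotheses (m0 : (0 < m)%N) (iidY : iid_signed_basis P Y).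

Local Notation signs N := {ffun 'I_n * 'I_N -> bool}.
Local Notation bins N := {ffun 'I_n * 'I_N -> 'I_m}.

(** Singletons are closed, as intersections of preimages under the
    coordinates. *)
Lemma borel_set1 (v : 'rV[R]_m) : borel_set [set v].
Proof.
rewrite -[[set v]]setCK; apply: sigma_algebraC; apply: sub_sigma_algebra.
rewrite /= openC.
have -> : [set v] = \bigcap_(k in [set: 'I_m]) ((fun u : 'rV[R]_m => u ord0 k) @^-1` [set x | x = v ord0 k]).
  apply/seteqP; split => [u -> //|u h]; apply/rowP => k; exact: h.
apply: closed_bigI => k _; apply: (@preimage_closed _ _ (fun u : 'rV[R]_m => u ord0 k)).
  by move=> u _; exact: coord_continuous.
exact: closed_eq.
Qed.

Lemma signed_basis_entry (c : bool) (k k' : 'I_m) :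
  ((-1) ^+ c *: delta_mx ord0 k : 'rV[R]_m) ord0 k' = (-1) ^+ c * (k == k')%:R.
Proof. by rewrite !mxE eqxx /= eq_sym. Qed.

Lemma signed_basis_inj (c c' : bool) (k k' : 'I_m) :
  (-1) ^+ c *: delta_mx ord0 k = (-1) ^+ c' *: delta_mx ord0 k' :> 'rV[R]_m ->
  c = c' /\ k = k'.
Proof.
move=> /rowP h; have := h k; rewrite !signed_basis_entry eqxx mulr1.
case: eqVneq => [->|_]; last by move/eqP; rewrite mulr0 signr_eq0.
rewrite mulr1 => hc; split => //; move: hc; case: c c' {h} => -[]//=;
rewrite ?expr0 ?expr1 => /eqP; first by rewrite eqNr oner_eq0.
by rewrite eq_sym eqNr oner_eq0.
Qed.

Definition outcome N (ek : signs N * bins N) : set Omega :=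
  [set w | forall ij : 'I_n * 'I_N,
     Y ij.1 ij.2 w = (-1) ^+ ek.1 ij *: delta_mx ord0 (ek.2 ij)].

(** Mutual independence is applied to the finite set [J] of the index pairs
    with [j < N]; [B] is the singleton prescribed by [ek] on [J], and the whole
    space elsewhere. *)
Lemma outcome_prob N (ek : signs N * bins N) :
  measurable (outcome ek) /\
  P (outcome ek) = (((2 * m%:R)^-1) ^+ #|{: 'I_n * 'I_N}|)%:E.
Proof.
pose phi (ij : 'I_n * 'I_N) : 'I_n * nat := (ij.1, val ij.2).
have phi_inj : injective phi by move=> [i j] [i' j'] [-> /val_inj ->].
pose J : {fset 'I_n * nat} := seq_fset tt (map phi (enum {: 'I_n * 'I_N})).
pose B (x : 'I_n * nat) : set 'rV[R]_m :=
  if insub x.2 is Some j then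
    [set (-1) ^+ ek.1 (x.1, j) *: delta_mx ord0 (ek.2 (x.1, j))] else setT.
have Bphi ij : B (phi ij) = [set (-1) ^+ ek.1 ij *: delta_mx ord0 (ek.2 ij)].
  by rewrite /B /phi /= valK; case: ij.
have JP x : x \in J -> exists ij, x = phi ij.
  by rewrite seq_fsetE => /mapP[ij _ ->]; exists ij.
have phiJ ij : phi ij \in J by rewrite seq_fsetE map_f// mem_enum.
have eqO : outcome ek = \bigcap_(x in [set` J]) (Y x.1 x.2 @^-1` B x).
  apply/seteqP; split => [w h x /= /JP[ij ->]|w h ij].
    by rewrite /preimage /= Bphi; exact: h.
  by have := h _ (phiJ ij); rewrite /preimage /= Bphi.
have [unif ind] := iidY.
have BJ x : x \in J -> borel_set (B x).
  by move=> /JP[ij ->]; rewrite Bphi; exact: borel_set1.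
split.
  rewrite eqO; apply: fin_bigcap_measurable => [|x /= xJ]; first exact: finite_fset.
  by have [mY _] := unif x.1 x.2; apply: mY; exact: BJ.
rewrite eqO (ind J B BJ).
rewrite (perm_big _ (seq_fset_perm tt _)) /= undup_id; last first.
  by rewrite map_inj_uniq ?enum_uniq.
rewrite big_map (eq_bigr (fun=> ((2 * m%:R)^-1)%:E)); last first.
  move=> ij _; rewrite Bphi; have [_ ->//] := unif ij.1 ij.2.
by rewrite big_enum /= prodEFin prodr_const.
Qed.

(** The outcomes [outcome ek] are disjoint and their probabilities sum to 1, so
    the complement of those with [~~ Q ek] has probability [#|Q|] divided by the
    number of configurations. It also contains the negligible set where some
    [Y i j] is not a signed basis vector. *)
Lemma transfer N (Q : pred (signs N * bins N)) (c : R) :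
  (#|[set ek | Q ek]%SET|)%:R
    <= c * (2 ^+ #|{: 'I_n * 'I_N}| * m%:R ^+ #|{: 'I_n * 'I_N}|) ->
  exists A : set Omega, [/\ measurable A, (P A <= c%:E)%E &
    forall w, ~ A w -> exists2 ek, ~~ Q ek & outcome ek w].
Proof.
set W := _ * m%:R ^+ _ => hc.
have W0 : 0 < W by rewrite mulr_gt0 ?exprn_gt0 ?ltr0n.
pose good := enum [pred ek | ~~ Q ek].
pose U := \bigcup_(ek in [set` good]) outcome ek.
have mO (ek : signs N * bins N) : measurable (outcome ek) by case: (outcome_prob ek).
have mU : measurable U.
  by apply: fin_bigcup_measurable => [|ek _]; [exact: finite_seq|exact: mO].
exists (~` U); split; first exact: measurableC.
  rewrite probability_setC//.
  have -> : P U = ((#|[set ek | ~~ Q ek]%SET|)%:R * W^-1)%:E.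
    rewrite /U measure_fin_bigcup//; last first.
    - move=> ek ek' _ _ [w [h h']].
      suff e ij : ek.1 ij = ek'.1 ij /\ ek.2 ij = ek'.2 ij.
        rewrite (surjective_pairing ek) (surjective_pairing ek').
        by congr (_, _); apply/ffunP => ij; have [] := e ij.
      by apply: signed_basis_inj; rewrite -h -h'.
    rewrite -fsbig_seq ?enum_uniq// (eq_bigr (fun=> (W^-1)%:E)); last first.
      move=> ek _; apply: etrans (outcome_prob ek).2 _.
      by rewrite /W -exprMn exprVn.
    rewrite sumEFin big_enum /= sumr_const; congr (_%:E).
    by rewrite -[LHS]mulr_natl; congr (_%:R * _); apply: eq_card => ek; rewrite !inE.
  rewrite -EFinB lee_fin; set a := #|_|.
  have cW : #|[set ek | Q ek]%SET|%:R + a%:R = W.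
    rewrite -natrD /a (_ : [set ek | ~~ Q ek]%SET = (~: [set ek | Q ek])%SET); last first.
      by apply/setP => ek; rewrite !inE.
    by rewrite cardsC card_prod !card_ffun card_bool card_ord natrM !natrX.
  have -> : 1 - a%:R / W = #|[set ek | Q ek]%SET|%:R / W.
    by rewrite -{1}(divff (lt0r_neq0 W0)) -mulrBl -cW addrK.
  by rewrite ler_pdivrMr.
move=> w /contrapT[ek /= ekg h]; exists ek => //.
by move: ekg; rewrite mem_enum inE.
Qed.

End FiniteTruncation.

(** * Truncations of the operator *)

Section Truncation.
Context {d : measure_display} {Omega : measurableType d} {R : realType}.
Variables (P : probability Omega R) (n m : nat).
Variable (Y : 'I_n -> nat -> Omega -> 'rV[R]_m).
Variable (p : R).
Hypotheses (m0 : (0 < m)%N) (p0 : 0 < p).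

Definition S_part (N : nat) (w : Omega) (x : 'rV[R]_n) : 'rV[R]_m :=
  \sum_(i < n) x ord0 i *: S_series p Y w i N.

Lemma S_series_entry w i N k :
  S_series p Y w i N ord0 k =
    \sum_(j < N) j.+1%:R `^ (- p^-1) * Y i j w ord0 k.
Proof.
rewrite /S_series /series /= big_mkord summxE; apply: eq_bigr => j _.
by rewrite mxE powRN.
Qed.

Lemma outcome_entry N ek w i (j : 'I_N) k : outcome Y ek w ->
  Y i j w ord0 k = (-1) ^+ ek.1 (i, j) * (ek.2 (i, j) == k)%:R.
Proof. by move=> /(_ (i, j)) /= ->; rewrite signed_basis_entry. Qed.

Lemma S_part_entry N (ek : {ffun 'I_n * 'I_N -> bool} * {ffun 'I_n * 'I_N -> 'I_m})
    w x k : outcome Y ek w ->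
  S_part N w x ord0 k = m%:R `^ (- p^-1) * throw (@coef R p m n N x) ek.1 ek.2 k.
Proof.
move=> ow; rewrite /S_part summxE /throw [in RHS]big_mkcond mulr_sumr /=.
rewrite [RHS](eq_bigr (fun ij : 'I_n * 'I_N => x ord0 ij.1 *
    (ij.2.+1%:R `^ (- p^-1) * Y ij.1 ij.2 w ord0 k))).
  rewrite -(pair_bigA _ (fun i (j : 'I_N) => x ord0 i * (j.+1%:R `^ (- p^-1) * Y i j w ord0 k))) /=.
  by apply: eq_bigr => i _; rewrite mxE S_series_entry mulr_sumr.
have mp : m%:R `^ (- p^-1) * m%:R `^ p^-1 = 1 :> R.
  by rewrite -powRDp ?ltr0n// addNr powRr0.
move=> [i j] _; rewrite (outcome_entry _ _ _ ow) /coef /=.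
case: eqP => _ /=; last by rewrite !mulr0.
rewrite mulr1 !mulrA mp mul1r; ring.
Qed.

Lemma lnormZ (s : R) M a (v : 'rV[R]_M) : 0 < s -> lnorm s (a *: v) = `|a| * lnorm s v.
Proof.
move=> s0; rewrite /lnorm -/(psum s (a *: v)) psumZ powRM ?powR_ge0 ?psum_ge0//.
by rewrite -powRrM divff ?gt_eqF// powRr1.
Qed.

(** The powers of [m] cancel by [p^-1 + q^-1 = r^-1]. *)
Lemma lnorm_S_part (r q : R) N ek w x : 0 < r -> p^-1 + q^-1 = r^-1 ->
  outcome Y ek w ->
  (m%:R `^ q^-1)^-1 * lnorm r (S_part N w x) = (@Phi R p r m n N ek x) `^ r^-1.
Proof.
move=> r0 hq ow; have mR : 0 < m%:R :> R by rewrite ltr0n.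
have -> : S_part N w x = m%:R `^ (- p^-1) *: \row_k throw (coef p m x) ek.1 ek.2 k.
  by apply/rowP => k; rewrite !mxE (S_part_entry _ _ ow).
rewrite lnormZ// ger0_norm ?powR_ge0// -powRN mulrA -powRDp//.
have -> : - q^-1 + - p^-1 = - r^-1 by rewrite -hq; ring.
have S0 : 0 <= \sum_k `|throw (coef p m x) ek.1 ek.2 k| `^ r.
  by apply: sumr_ge0 => k _; exact: powR_ge0.
have m1 : 0 <= m%:R^-1 :> R by rewrite invr_ge0 ltW.
rewrite /Phi (powRM _ m1 S0) -[in RHS](powR_inv1 (ltW mR)) -powRrM mulN1r.
congr (_ * _ `^ _).
by apply: eq_bigr => k _; rewrite mxE.
Qed.

Lemma truncated_bounds (r q : R) N ek w (k : R) : 0 < r -> r < p -> p < 2 ->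
  p^-1 + q^-1 = r^-1 -> outcome Y ek w -> @all_sparse_bounds R p r m n N k ek ->
  forall x : 'rV[R]_n, sparse k x ->
    (tiny / 2) `^ r^-1 * lnorm p x
      <= (m%:R `^ q^-1)^-1 * lnorm r (S_part N w x)
      <= (2 * upper_const p r) `^ r^-1 * lnorm p x.
Proof.
move=> r0 rp p2 hq ow h x xk; rewrite (lnorm_S_part _ r0 hq ow).
have -> : lnorm p x = (psum p x `^ (r / p)) `^ r^-1.
  by rewrite /lnorm -/(psum p x) -powRrM mulrAC divff ?mul1r// gt_eqF.
have u0 := upper_const_ge3 r0 rp p2.
have t0 := @tiny_gt0 R.
rewrite -!powRM ?powR_ge0//; [|by lra|by lra].
have mon (a b : R) : 0 <= a -> a <= b -> a `^ r^-1 <= b `^ r^-1.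
  move=> a0 ab; apply: ge0_ler_powR; rewrite ?nnegrE ?invr_ge0 ?(ltW r0)//.
  exact: le_trans ab.
have /andP[h1 h2] := h x xk.
have low0 : 0 <= tiny / 2 * psum p x `^ (r / p) by rewrite mulr_ge0 ?powR_ge0//; lra.
by rewrite !mon//; apply: le_trans h1.
Qed.

Lemma S_part_cvg w x k : S_defined p Y w ->
  (fun N => S_part N w x ord0 k) @ \oo --> S_op p Y w x ord0 k.
Proof.
move=> Sw; have -> : (fun N => S_part N w x ord0 k) =
    (fun N => \sum_(i < n) x ord0 i * S_series p Y w i N ord0 k).
  by apply/funext => N; rewrite summxE; apply: eq_bigr => i _; rewrite mxE.
rewrite summxE; apply: (@cvg_big _ _ +%R 0) => [|i _]; first exact: add_continuous.
rewrite mxE; apply: cvgMr.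
exact: (cvg_comp _ _ (Sw i) (@coord_continuous _ _ _ _ _ _)).
Qed.

Lemma lnorm_S_part_cvg (r : R) w x : 0 < r -> S_defined p Y w ->
  (fun N => lnorm r (S_part N w x)) @ \oo --> lnorm r (S_op p Y w x).
Proof. by move=> r0 Sw; apply: cvg_lnorm => // k; exact: S_part_cvg. Qed.

Lemma S_defined_coord w :
  (forall i k, cvgn (series (fun j => j.+1%:R `^ (- p^-1) * Y i j w ord0 k))) <->
  S_defined p Y w.
Proof.
have E i k : (fun N => S_series p Y w i N ord0 k) =
    series (fun j => j.+1%:R `^ (- p^-1) * Y i j w ord0 k).
  by apply/funext => N; rewrite S_series_entry /series /= big_mkord.
split => h; last first.
  move=> i k; rewrite -E; apply: cvgP.
  exact: (cvg_comp _ _ (h i) (@coord_continuous _ _ _ _ _ _)).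
move=> i; pose l k := limn (series (fun j => j.+1%:R `^ (- p^-1) * Y i j w ord0 k)).
apply: (@cvgP _ _ (\sum_k l k *: delta_mx ord0 k)).
have -> : S_series p Y w i =
    (fun N => \sum_k S_series p Y w i N ord0 k *: delta_mx ord0 k).
  by apply/funext => N; exact: row_sum_delta.
apply: (@cvg_big _ _ +%R 0) => [|k _]; first exact: add_continuous.
apply: cvgZr_tmp; rewrite E; exact: h.
Qed.

End Truncation.

(** * Almost sure convergence of the series *)

Section AlmostSure.
Context {d : measure_display} {Omega : measurableType d} {R : realType}.
Variables (P : probability Omega R) (n m : nat).
Variable (Y : 'I_n -> nat -> Omega -> 'rV[R]_m).
Hypotheses (m0 : (0 < m)%N) (iidY : iid_signed_basis P Y).

(** Hoeffding's inequality for a coordinate of the sum of the first [j] vectors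
    of row [i], with parameter [lam = (j + 1) `^ (- 1/2)]; the threshold is
    chosen to make the bound summable in [j]. *)
Lemma card_walk_tail (i : 'I_n) (k : 'I_m) j :
  (#|[set ek : {ffun 'I_n * 'I_j -> bool} * {ffun 'I_n * 'I_j -> 'I_m} |
      j.+1%:R `^ (1 / 2) * (3 + 2 * ln j.+1%:R)
        < `|\sum_(l < j) (-1) ^+ ek.1 (i, l) * (ek.2 (i, l) == k)%:R : R|]%SET|)%:R
   <= 2 * (j.+1%:R `^ (- 2)) *
      (2 ^+ #|{: 'I_n * 'I_j}| * m%:R ^+ #|{: 'I_n * 'I_j}|) :> R.
Proof.
have j0 : 0 < j.+1%:R :> R by rewrite ltr0n.
pose lam : R := j.+1%:R `^ (- (1 / 2)).
have lam0 : 0 < lam by exact: powR_gt0.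
have lam1 : lam * j.+1%:R `^ (1 / 2) = 1 by rewrite -powRDp// addNr powRr0.
pose L : R := 3 + 2 * ln j.+1%:R.
rewrite card_set_pair /=.
have onesided (kap : {ffun 'I_n * 'I_j -> 'I_m}) (s : bool) :
   (#|[set e : {ffun 'I_n * 'I_j -> bool} |
     L < \sum_ij (-1) ^+ s * lam * ((ij.1 == i) && (kap ij == k))%:R * (-1) ^+ e ij]%SET|)%:R
   <= 2 ^+ #|{: 'I_n * 'I_j}| * j.+1%:R `^ (- 2) :> R.
  apply: le_trans (card_sign_tail _ _) _; rewrite ler_wpM2l ?exprn_ge0//.
  rewrite [leRHS]powR_expR// ler_expR.
  have : \sum_(ij : 'I_n * 'I_j) ((-1) ^+ s * lam * ((ij.1 == i) && (kap ij == k))%:R) ^+ 2 <= 1.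
    apply: (@le_trans _ _ (\sum_(ij : 'I_n * 'I_j) if ij.1 == i then lam ^+ 2 else 0)).
      apply: ler_sum => ij _; rewrite !exprMn sqrr_sign mul1r.
      case: (ij.1 == i) => /=; last by rewrite expr0n mulr0.
      by case: (kap ij == k); rewrite ?expr1n ?mulr1// expr0n mulr0 sqr_ge0.
    rewrite -(pair_bigA _ (fun i' (l : 'I_j) => if i' == i then lam ^+ 2 else 0)) /=.
    rewrite (bigD1 i)//= [X in _ + X]big1 ?addr0; last first.
      by move=> i' /negbTE ->; rewrite big1.
    rewrite eqxx sumr_const card_ord -[leLHS]mulr_natl.
    have -> : lam ^+ 2 = j.+1%:R^-1.
      rewrite -powR_mulrn ?(ltW lam0)// -powRrM mulNr div1r mulVf//.
      by rewrite powR_inv1// ltW.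
    by rewrite ler_pdivrMr// mul1r ler_nat.
  rewrite /L; set V := \sum_ij _; lra.
apply: (@le_trans _ _ (\sum_(kap : {ffun 'I_n * 'I_j -> 'I_m})
   2 * (2 ^+ #|{: 'I_n * 'I_j}| * j.+1%:R `^ (- 2)))).
  apply: ler_sum => kap _.
  apply: le_trans (card_le_cover (Q := predT) (B := fun (s : bool) (e : {ffun 'I_n * 'I_j -> bool}) =>
     L < \sum_ij (-1) ^+ s * lam * ((ij.1 == i) && (kap ij == k))%:R * (-1) ^+ e ij) _) _.
    move=> e; set T := \sum_(l < j) _ => hT.
    have E (s : bool) : \sum_ij (-1) ^+ s * lam * ((ij.1 == i) && (kap ij == k))%:R * (-1) ^+ e ij
       = lam * ((-1) ^+ s * T).
      rewrite (eq_bigr (fun ij : 'I_n * 'I_j => (-1) ^+ s * lam *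
         (((ij.1, ij.2).1 == i) && (kap (ij.1, ij.2) == k))%:R * (-1) ^+ e (ij.1, ij.2))); last by case.
      rewrite -(pair_bigA _ (fun i' (l : 'I_j) => (-1) ^+ s * lam *
         ((i' == i) && (kap (i', l) == k))%:R * (-1) ^+ e (i', l))) /=.
      rewrite (bigD1 i)//= [X in _ + X]big1 ?addr0; last first.
        by move=> i' /negbTE h; apply: big1 => l _; rewrite h /= mulr0 mul0r.
      rewrite /T mulr_sumr mulr_sumr; apply: eq_bigr => l _; rewrite eqxx /=; ring.
    have key : L < lam * `|T|.
      have := hT; rewrite -(ltr_pM2l lam0) mulrA lam1 mul1r; exact.
    have [T0|T0] := lerP 0 T.
      by exists false => //; rewrite E expr0 mul1r; move: key; rewrite ger0_norm.
    by exists true => //; rewrite E expr1 mulN1r; move: key; rewrite ltr0_norm.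
  rewrite big_bool; apply: le_trans (lerD (onesided kap true) (onesided kap false)) _; lra.
rewrite sumr_const card_ffun card_ord -[leLHS]mulr_natl natrX.
by rewrite le_eqVlt; apply/orP; left; apply/eqP; ring.
Qed.

Lemma ln_le_powR (x g : R) : 0 < x -> 0 < g -> ln x <= x `^ g / g.
Proof.
move=> x0 g0; rewrite ler_pdivlMr// mulrC -ln_powR.
by apply/ltW/ln_sublinear; exact: powR_gt0.
Qed.

(** By the Borel-Cantelli lemma the bound of [card_walk_tail] holds for all
    large [j], and the logarithm is absorbed by any power. The constant [K] is
    enlarged to cover the finitely many remaining [j]. *)
Lemma walk_growth (i : 'I_n) (k : 'I_m) (beta : R) : 1 / 2 < beta ->
  \forall w \ae P, exists K : R,
    forall j, `|\sum_(l < j) Y i l w ord0 k| <= K * j.+1%:R `^ beta.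
Proof.
move=> hb.
have /choice[A hA] j : exists A : set Omega, [/\ measurable A,
    (P A <= (2 * (j.+1%:R `^ (- 2)))%:E)%E & forall w, ~ A w ->
    `|\sum_(l < j) Y i l w ord0 k| <= j.+1%:R `^ (1 / 2) * (3 + 2 * ln j.+1%:R)].
  have [A [mA PA hA]] := transfer m0 iidY (card_walk_tail i k j).
  exists A; split => // w /hA[ek nq ow]; rewrite leNgt; move: nq; apply: contra.
  have -> : \sum_(l < j) Y i l w ord0 k =
     \sum_(l < j) (-1) ^+ ek.1 (i, l) * (ek.2 (i, l) == k)%:R.
    by apply: eq_bigr => l _; exact: outcome_entry.
  by [].
have mA j : measurable (A j) by case: (hA j).
exists (lim_sup_set A); split.
- apply: bigcapT_measurable => j; exact: bigcup_measurable.
- apply: lim_sup_set_cvg0 => //.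
  apply: (@le_lt_trans _ _ (16%:E)); last exact: ltry.
  apply: lime_le; first by apply: is_cvg_nneseries => *; exact: measure_ge0.
  apply: nearW => N.
  apply: (@le_trans _ _ (\sum_(0 <= j < N) (2 * (j.+1%:R `^ (- 2)))%:E)%E).
    by apply: lee_sum => j _; case: (hA j).
  rewrite sumEFin lee_fin big_mkord -mulr_sumr.
  by have := @sum_inv_sqr_le8 R N; lra.
move=> w /= nK; apply: contrapT => nlim; apply: nK.
have [j0 hj0] : exists j0, forall j, (j0 <= j)%N -> ~ A j w.
  apply: contrapT => h; apply: nlim => j _; apply: contrapT => h2; apply: h.
  by exists j => l jl Al; apply: h2; exists l.
pose g := beta - 1 / 2.
have g0 : 0 < g by rewrite /g; lra.
pose K1 := 3 + 2 / g.
have K10 : 0 < K1 by rewrite addr_gt0// divr_gt0.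
exists (K1 + \sum_(j < j0) `|\sum_(l < j) Y i l w ord0 k|) => j.
have jb1 : 1 <= j.+1%:R `^ beta :> R.
  rewrite -[leLHS](powRr0 j.+1%:R); apply: ler_powR; last by lra.
  by rewrite ler1n.
have S0 : 0 <= \sum_(j < j0) `|\sum_(l < j) Y i l w ord0 k| by apply: sumr_ge0.
have [jj|jj] := ltnP j j0.
  have h : `|\sum_(l < j) Y i l w ord0 k| <= \sum_(j < j0) `|\sum_(l < j) Y i l w ord0 k|.
    by rewrite (bigD1 (Ordinal jj))//= lerDl sumr_ge0.
  apply: (le_trans h); nra.
have [_ _ /(_ w (hj0 j jj)) h] := hA j.
apply: (le_trans h).
apply: (@le_trans _ _ (K1 * j.+1%:R `^ beta)); last first.
  by rewrite ler_wpM2r ?powR_ge0// lerDl.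
have jp : 0 < j.+1%:R :> R by rewrite ltr0n.
have -> : beta = 1 / 2 + g by rewrite /g; ring.
rewrite powRDp// [leRHS]mulrCA ler_wpM2l ?powR_ge0// /K1.
have l1 := ln_le_powR jp g0.
have l2 : 1 <= j.+1%:R `^ g :> R.
  rewrite -[leLHS](powRr0 j.+1%:R); apply: ler_powR; last by lra.
  by rewrite ler1n.
set G := j.+1%:R `^ g in l1 l2 *.
have -> : (3 + 2 / g) * G = 3 * G + 2 * (G / g) by ring.
lra.
Qed.

Lemma S_defined_ae (p : R) : 0 < p -> p < 2 -> \forall w \ae P, S_defined p Y w.
Proof.
move=> p0 p2.
(* [beta] is the midpoint of [1 / 2] and [p^-1]. *)
pose beta : R := 1 / 4 + 1 / 2 * p^-1.
have pi : 1 / 2 < p^-1 by rewrite div1r ltf_pV2 ?posrE.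
have : \forall w \ae P, forall i k, exists K : R,
    forall j, `|\sum_(l < j) Y i l w ord0 k| <= K * j.+1%:R `^ beta.
  apply: filter_forall => i; apply: filter_forall => k.
  by apply: walk_growth; rewrite /beta; lra.
apply: filterS => w h; apply/S_defined_coord => i k; have [K hK] := h i k.
by apply: cvg_series_abel hK; rewrite /beta; lra.
Qed.

End AlmostSure.

(** * Measurability of the good event *)

Section Measurability.
Context {d : measure_display} {Omega : measurableType d} {R : realType}.
Variables (P : probability Omega R).

(** Convergence is the Cauchy condition, which involves countably many
    measurable conditions. *)
Lemma measurable_cvgn_set (u : nat -> Omega -> R) :
  (forall N, measurable_fun setT (u N)) ->
  measurable [set w | cvgn (fun N => u N w)].
Proof.
move=> mu.
have -> : [set w | cvgn (fun N => u N w)] =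
  \bigcap_e \bigcup_N \bigcap_M
    [set w | `|u (N + M)%N w - u N w| < (e.+1%:R)^-1].
  apply/seteqP; split => w /=.
    move=> cu e _.
    have e0 : 0 < (e.+1%:R)^-1 / 2 :> R by rewrite divr_gt0// invr_gt0 ltr0n.
    have [N _ hN] := (@cvgrPdist_lt _ _ _ _ _ _ _).1 cu _ e0.
    exists N => // M _ /=.
    have h1 := hN (N + M)%N (leq_addr _ _); have h2 := hN N (leqnn _).
    have -> : u (N + M)%N w - u N w =
      (lim (u x w @[x --> \oo]) - u N w) - (lim (u x w @[x --> \oo]) - u (N + M)%N w) by ring.
    apply: le_lt_trans (ler_normB _ _) _; rewrite [ltRHS]splitr.
    exact: ltrD.
  move=> h; apply/cauchy_cvgP; apply/cauchy_exP => e e0.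
  have [k hk] : exists k : nat, (k.+1%:R)^-1 < e.
    exists (Num.truncn e^-1); rewrite invf_plt ?posrE//.
    by have /truncn_itv/andP[] : 0 <= e^-1 by rewrite invr_ge0 ltW.
  have [N _ hN] := h k I; exists (u N w); exists N => // M NM /=.
  rewrite /ball /= distrC; apply: lt_trans hk.
  by have := hN (M - N)%N I; rewrite /= subnKC.
apply: bigcapT_measurable => e; apply: bigcupT_measurable => N.
apply: bigcapT_measurable => M.
have mf : measurable_fun setT (fun w => `|u (N + M)%N w - u N w|).
  apply: measurableT_comp => //; exact: measurable_funB.
have := mf measurableT _ (measurable_itv `]-oo, (e.+1%:R)^-1[).
by rewrite setTI; congr (measurable _); apply/seteqP; split => w /=; rewrite in_itv.
Qed.

Lemma liminf_measure_le (A : nat -> set Omega) (a : \bar R) :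
  (forall N, measurable (A N)) -> (forall N, (P (A N) <= a)%E) ->
  (P (\bigcup_N \bigcap_M A (N + M)%N) <= a)%E.
Proof.
move=> mA hA; pose F N := \bigcap_M A (N + M)%N.
have mF N : measurable (F N) by apply: bigcapT_measurable.
have : P (F N) @[N --> \oo] --> P (\bigcup_N F N).
  apply: nondecreasing_cvg_mu => //; first exact: bigcup_measurable.
  move=> N N' NN'; apply/subsetPset => w h M _.
  by have := h (N' - N + M)%N I; rewrite addnA subnKC.
move=> /cvg_lim <-//; apply: lime_le.
  apply: (@cvgP _ _ (P (\bigcup_N F N))).
  apply: nondecreasing_cvg_mu => //; first exact: bigcup_measurable.
  move=> N N' NN'; apply/subsetPset => w h M _.
  by have := h (N' - N + M)%N I; rewrite addnA subnKC.
apply: nearW => N; apply: le_trans (hA N); apply: le_measure; rewrite ?inE//.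
by move=> w h; have := h 0%N I; rewrite addn0.
Qed.

Variables (n m : nat) (Y : 'I_n -> nat -> Omega -> 'rV[R]_m).
Hypotheses (iidY : iid_signed_basis P Y).
Variables (p r : R).
Hypotheses (p0 : 0 < p) (r0 : 0 < r).

Lemma measurable_entry i j k : measurable_fun setT (fun w => Y i j w ord0 k).
Proof.
move=> mT; apply: (measurability _ (RGenOInfty.measurableE R)) => //.
move=> _ [_ [x ->] <-]; rewrite setTI.
have [[mY _] _] := (iidY.1 i j, tt).
apply: (mY ((fun v : 'rV[R]_m => v ord0 k) @^-1` `]x, +oo[%classic)).
apply: sub_sigma_algebra => /=; apply: open_comp; last exact: interval_open.
by move=> v _; exact: coord_continuous.
Qed.

Lemma measurable_S_series i N k :
  measurable_fun setT (fun w => S_series p Y w i N ord0 k).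
Proof.
apply: (eq_measurable_fun (fun w => \sum_(j < N) j.+1%:R `^ (- p^-1) * Y i j w ord0 k)).
  by move=> w _; rewrite S_series_entry.
apply: measurable_sum => j; apply: measurable_funM => //; exact: measurable_entry.
Qed.

Lemma measurable_lnorm_S_part N x :
  measurable_fun setT (fun w => lnorm r (S_part Y p N w x)).
Proof.
apply: (measurableT_comp (measurable_powR r^-1)).
apply: measurable_sum => k; apply: (measurableT_comp (measurable_powR r)).
apply: measurableT_comp => //.
apply: (eq_measurable_fun (fun w => \sum_(i < n) x ord0 i * S_series p Y w i N ord0 k)).
  by move=> w _; rewrite /S_part summxE; apply: eq_bigr => i _; rewrite mxE.
apply: measurable_sum => i; apply: measurable_funM => //; exact: measurable_S_series.
Qed.

Lemma measurable_S_defined : measurable [set w | S_defined p Y w].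
Proof.
have -> : [set w | S_defined p Y w] =
  \bigcap_(i in [set: 'I_n]) \bigcap_(k in [set: 'I_m])
    [set w | cvgn (fun N => S_series p Y w i N ord0 k)].
  have E w i k : (fun N => S_series p Y w i N ord0 k) =
      series (fun j => j.+1%:R `^ (- p^-1) * Y i j w ord0 k).
    by apply/funext => N; rewrite S_series_entry /series /= big_mkord.
  apply/seteqP; split => w /= => [/S_defined_coord h i _ k _ /=|h].
    by rewrite E; exact: h.
  by apply/S_defined_coord => i k; rewrite -E; exact: h.
apply: fin_bigcap_measurable => [|i _]; first exact: finite_finset.
apply: fin_bigcap_measurable => [|k _]; first exact: finite_finset.
by apply: measurable_cvgn_set => N; exact: measurable_S_series.
Qed.

Section Bounds.
Variables (k kappa c C : R).

Definition bounds_at (w : Omega) (x : 'rV[R]_n) : Prop :=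
  c * lnorm p x <= kappa * lnorm r (S_op p Y w x) <= C * lnorm p x.

Lemma measurable_bounds_at x :
  measurable ([set w | S_defined p Y w] `&` [set w | bounds_at w x]).
Proof.
have mD := measurable_S_defined.
have mf : measurable_fun [set w | S_defined p Y w] (fun w => kappa * lnorm r (S_op p Y w x)).
  apply: measurable_funM => //.
  apply: (measurable_fun_cvg (h := fun N w => lnorm r (S_part Y p N w x))).
    by move=> N; apply: measurable_funS (measurable_lnorm_S_part N x).
  by move=> w Dw; exact: lnorm_S_part_cvg.
have := mf mD _ (measurable_itv `[c * lnorm p x, C * lnorm p x]).
by congr (measurable (_ `&` _)); apply/seteqP; split => w /=; rewrite in_itv.
Qed.

(** Zero entries are approximated by 0, so that sparsity is preserved. *)
Lemma rat_approx (x : 'rV[R]_n) : exists v : nat -> 'rV[rat]_n,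
  (forall N, (supp (map_mx ratr (v N) : 'rV[R]_n) \subset supp x)%SET) /\
  forall i, (fun N => (map_mx ratr (v N) : 'rV[R]_n) ord0 i) @ \oo --> x ord0 i.
Proof.
have ex N (t : R) : exists q : rat, (t = 0 -> q = 0) /\ `|t - ratr q| <= harmonic N.
  have [->|t0] := eqVneq t 0.
    by exists 0; split => //; rewrite rmorph0 subr0 normr0 /harmonic /= invr_ge0.
  have h0 : 0 < harmonic N :> R by rewrite /harmonic /= invr_gt0 ltr0n.
  move: (harmonic N) h0 => h h0; have : t - h < t + h by lra.
  move=> /rat_in_itvoo[q]; rewrite in_itv /= => /andP[q1 q2].
  exists q; split; first by move/eqP: t0.
  by rewrite ler_norml; apply/andP; split; lra.
have /choice[v hv] N : exists v : 'rV[rat]_n, forall i,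
    (x ord0 i = 0 -> v ord0 i = 0) /\ `|x ord0 i - ratr (v ord0 i)| <= harmonic N.
  have /choice[f hf] i := ex N (x ord0 i).
  by exists (\row_i f i) => i; rewrite mxE.
exists v; split => [N|i].
  apply/fintype.subsetP => i; rewrite !inE mxE; apply: contra => /eqP xi.
  by rewrite (hv N i).1// rmorph0.
apply/cvgrPdist_le => e e0.
have := @cvg_harmonic R => /cvgrPdist_le /(_ _ e0); apply: filterS => N.
rewrite sub0r normrN => hN; rewrite mxE.
apply: le_trans (hv N i).2 (le_trans (ler_norm _) hN).
Qed.

Lemma bounds_at_limit w (x : 'rV[R]_n) (v : nat -> 'rV[R]_n) :
  (forall i, (fun N => v N ord0 i) @ \oo --> x ord0 i) ->
  (forall N, bounds_at w (v N)) -> bounds_at w x.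
Proof.
move=> vx hv.
have cp : (fun N => lnorm p (v N)) @ \oo --> lnorm p x by apply: cvg_lnorm.
have cS : (fun N => lnorm r (S_op p Y w (v N))) @ \oo --> lnorm r (S_op p Y w x).
  apply: cvg_lnorm => // l.
  have E (y : 'rV[R]_n) : S_op p Y w y ord0 l =
      \sum_i y ord0 i * (limn (S_series p Y w i)) ord0 l.
    by rewrite summxE; apply: eq_bigr => i _; rewrite mxE.
  rewrite E; under eq_fun do rewrite E.
  apply: (@cvg_big _ _ +%R 0) => [|i _]; first exact: add_continuous.
  exact: cvgMl.
apply/andP; split.
  rewrite -subr_ge0.
  have : (fun N => kappa * lnorm r (S_op p Y w (v N)) - c * lnorm p (v N)) @ \oo -->
     kappa * lnorm r (S_op p Y w x) - c * lnorm p x.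
    by apply: cvgB; apply: cvgMr.
  move/cvgr_to_ge; apply; apply: nearW => N.
  by rewrite subr_ge0; have /andP[] := hv N.
rewrite -subr_ge0.
have : (fun N => C * lnorm p (v N) - kappa * lnorm r (S_op p Y w (v N))) @ \oo -->
   C * lnorm p x - kappa * lnorm r (S_op p Y w x).
  by apply: cvgB; apply: cvgMr.
move/cvgr_to_ge; apply; apply: nearW => N.
by rewrite subr_ge0; have /andP[] := hv N.
Qed.

(** Sparse vectors with rational entries suffice, by [rat_approx] and
    [bounds_at_limit]; they are enumerated by their codes. *)
Lemma measurable_all_bounds :
  measurable [set w | S_defined p Y w /\ forall x, sparse k x -> bounds_at w x].
Proof.
pose D := [set w | S_defined p Y w].
pose G (N : nat) : set Omega :=
  if @choice.unpickle 'rV[rat]_n N is Some v then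
    if `[< sparse k (map_mx ratr v : 'rV[R]_n) >] then
      D `&` [set w | bounds_at w (map_mx ratr v)] else D
  else D.
have -> : [set w | S_defined p Y w /\ forall x, sparse k x -> bounds_at w x] =
    D `&` \bigcap_N G N.
  apply/seteqP; split => w /= [Dw h]; split => //.
    move=> N _; rewrite /G; case: (@choice.unpickle 'rV[rat]_n N) => // v.
    by case: ifPn => // /asboolP sv; split => //; exact: h.
  move=> x sx; have [v [vs vx]] := rat_approx x.
  apply: bounds_at_limit vx _ => N.
  have := h (choice.pickle (v N)) I; rewrite /G choice.pickleK ifT; first by case.
  by apply/asboolP; exact: sparse_sub (vs N) sx.
apply: measurableI; first exact: measurable_S_defined.
apply: bigcapT_measurable => N; rewrite /G; case: (@choice.unpickle 'rV[rat]_n N) => [v|]; last exact: measurable_S_defined.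
by case: ifPn => _; [exact: measurable_bounds_at|exact: measurable_S_defined].
Qed.

End Bounds.

End Measurability.

(** * Choice of the sparsity *)

Section Constants.
Context {R : realType}.
Variables (p r : R).
Hypotheses (r0 : 0 < r) (rp : r < p).

Lemma rate_const_ge16 : 16 <= rate_const p r.
Proof.
rewrite /rate_const lerDr mulr_ge0 ?powR_ge0// divr_ge0// ltW//; exact: lt_trans rp.
Qed.

(** The square root of the constant in the sparsity; a square is convenient as
    [s ^ 2 ln (1 / s) <= s]. *)
Definition sparsity_root : R := tiny / (6 + 2 * rate_const p r).

Lemma sparsity_root_gt0 : 0 < sparsity_root.
Proof. by apply: divr_gt0; [exact: tiny_gt0|have := rate_const_ge16; lra]. Qed.

(** With [l = ln (1 + 1 / eta)], [delta n = s ^ 2 m / l], and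
    [ln (1 / delta) <= 2 l + 2 / s] since [l <= 1 / eta] and [ln (1 / eta) <= l].
    The product is at most [m (2 s ^ 2 + 2 s ^ 2 (2 / s + K))], of order [s m]. *)
Lemma sparsity_ok (eta : R) (n m : nat) : 0 < eta -> eta <= 1 -> eta * n%:R = m%:R ->
  let delta := sparsity_root ^+ 2 * eta / ln (1 + eta^-1) in
  [/\ 0 < delta, delta <= 1, delta * n%:R <= m%:R / 16 &
      delta * n%:R * (ln delta^-1 + rate_const p r) <= tiny * m%:R].
Proof.
move=> e0 e1 em; have K16 := rate_const_ge16; set K := rate_const p r in K16 *.
have s0 := sparsity_root_gt0; set s := sparsity_root in s0 *.
have sE : s * (6 + 2 * K) = tiny.
  by rewrite /s /sparsity_root -/K divfK// gt_eqF//; lra.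
have t0 := @tiny_gt0 R; have t2 := @tiny_le2 R.
have s8 : s <= 1 / 8 by nra.
have i1 : 1 <= eta^-1 by rewrite invf_ge1.
have ei0 : 0 < eta^-1 by lra.
pose l : R := ln (1 + eta^-1); rewrite -/l.
have l2 : 1 / 2 <= l.
  have h : ln 2 <= l by rewrite /l ler_ln ?posrE; lra.
  by apply: le_trans h; have := @ln_ge_1BV R 2 ltac:(lra); lra.
have l0 : 0 < l by lra.
have li : l <= eta^-1 by apply: le_ln1Dx; lra.
have lnl : ln l <= l.
  by rewrite {2}/l; apply: le_trans (_ : ln eta^-1 <= _); rewrite ler_ln ?posrE//; lra.
have lne : ln eta^-1 <= l by rewrite /l ler_ln ?posrE//; lra.
have m_ge0 : 0 <= m%:R :> R by [].
pose delta := s ^+ 2 * eta / l; rewrite /= -/delta.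
have d0 : 0 < delta.
  by apply: divr_gt0 => //; apply: mulr_gt0 => //; exact: exprn_gt0.
have dn : delta * n%:R = s ^+ 2 / l * m%:R.
  by rewrite -em /delta; ring.
have s2l : s ^+ 2 / l <= 2 * s ^+ 2.
  rewrite ler_pdivrMr//; have : 0 <= s ^+ 2 by exact: sqr_ge0.
  nra.
have s264 : s ^+ 2 <= 1 / 64 by nra.
split => //.
- rewrite /delta ler_pdivrMr// mul1r; have : s ^+ 2 * eta <= s ^+ 2 by rewrite ler_piMr ?sqr_ge0.
  lra.
- rewrite dn; apply: le_trans (ler_wpM2r m_ge0 s2l) _; nra.
have lnd : ln delta^-1 <= 2 * l + 2 / s.
  have -> : delta^-1 = l * eta^-1 * (s^-1 * s^-1).
    rewrite /delta; field; do ?[apply/andP; split]; by rewrite gt_eqF.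
  have si0 : 0 < s^-1 by rewrite invr_gt0.
  rewrite !lnM ?posrE ?mulr_gt0//.
  have : ln s^-1 <= s^-1 by apply/ltW/ln_sublinear.
  lra.
have h1 : ln delta^-1 + K <= 2 * l + 2 / s + K by lra.
have dn0 : 0 <= delta * n%:R by rewrite mulr_ge0// ltW.
apply: le_trans (ler_wpM2l dn0 h1) _.
rewrite dn -sE.
have -> : s ^+ 2 / l * m%:R * (2 * l + 2 / s + K) =
  m%:R * (2 * s ^+ 2 + s ^+ 2 / l * (2 / s + K)).
  by field; rewrite !gt_eqF.
rewrite [leRHS]mulrC ler_wpM2l//.
have q0 : 0 <= 2 / s + K.
  by have : 0 <= 2 / s; [apply: divr_ge0 => //; exact: ltW|lra].
apply: le_trans (lerD (lexx _) (ler_wpM2r q0 s2l)) _.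
have -> : 2 * s ^+ 2 * (2 / s + K) = 4 * s + 2 * K * s ^+ 2.
  by field; rewrite gt_eqF.
nra.
Qed.

End Constants.

Theorem corollary8 (R : realType) (p r q : R)
    (hr0 : 0 < r) (hrp : r < p) (hp2 : p < 2) (hr1 : r <= 1)
    (hq : p^-1 + q^-1 = r^-1) :
  exists c0 c C b : R,
    [/\ 0 < c0, 0 < c, 0 < C & 0 < b] /\
    forall (eta : R) (n m : nat),
      0 < eta -> eta <= 1 -> (0 < m)%N -> eta * n%:R = m%:R ->
    forall (d : measure_display) (Omega : measurableType d)
      (P : probability Omega R) (Y : 'I_n -> nat -> Omega -> 'rV[R]_m),
      iid_signed_basis P Y ->
    let delta := c0 * eta / ln (1 + eta^-1) in
    let good := [set w : Omega |
      S_defined p Y w /\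
      property_P1 p (lnorm r)
        (fun x : 'rV[R]_n => ((eta * n%:R) `^ q^-1)^-1 *: S_op p Y w x)
        (delta * n%:R) c C /\
      (forall x : 'rV[R]_n, sparse (delta * n%:R) x ->
        c * lnorm p x
          <= ((eta * n%:R) `^ q^-1)^-1 * lnorm r (S_op p Y w x)
          <= C * lnorm p x)] in
    measurable good /\
    ((1 - 2 * expR (- (b * eta * n%:R)))%:E < P good)%E.
Proof.
have p0 : 0 < p := lt_trans hr0 hrp.
have t0 := @tiny_gt0 R; have u3 := upper_const_ge3 hr0 hrp hp2.
exists (sparsity_root p r ^+ 2), ((tiny / 2) `^ r^-1),
  ((2 * upper_const p r) `^ r^-1), (tiny / 4); split.
  split; [by rewrite exprn_gt0// sparsity_root_gt0|apply: powR_gt0; lra|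
          apply: powR_gt0; lra|lra].
move=> eta n m e0 e1 m0 em d Omega P Y iidY delta good.
set c := _ `^ r^-1 in good *; set C := _ `^ r^-1 in good *.
have n0 : (0 < n)%N.
  by rewrite lt0n; apply/eqP => n0; move: em; rewrite n0 mulr0 => /esym/eqP; rewrite pnatr_eq0 gtn_eqF.
have [d0 d1 dm dr] := sparsity_ok hr0 hrp e0 e1 em.
rewrite -/delta in d0 d1 dm dr.
have goodE : good = [set w | S_defined p Y w /\
   forall x : 'rV[R]_n, sparse (delta * n%:R) x -> bounds_at Y p r (m%:R `^ q^-1)^-1 c C w x].
  apply/seteqP; rewrite /good /bounds_at em; split => w /= [Dw].
    by case=> _ h; split.
  move=> h; split => //; split => // x xk.
  by rewrite lnormZ// ger0_norm ?invr_ge0 ?powR_ge0//; exact: h.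
have mgood : measurable good by rewrite goodE; exact: (measurable_all_bounds iidY p0 hr0).
split => //.
(* Truncations start at [m], as the lower bound needs the first [m] terms. *)
have hA N : exists A : set Omega, [/\ measurable A,
    (P A <= (3 * expR (- (tiny * m%:R)))%:E)%E &
    forall w, ~ A w -> forall x : 'rV[R]_n, sparse (delta * n%:R) x ->
      c * lnorm p x <= (m%:R `^ q^-1)^-1 * lnorm r (S_part Y p (m + N) w x) <= C * lnorm p x].
  have [A [mA PA hA]] := transfer m0 iidY
    (card_not_all_sparse_bounds hr0 hrp hp2 hr1 m0 (leq_addr N m) d0 d1 n0 dm dr).
  exists A; split => // w /hA[ek]; rewrite negbK => /asboolP h ow.
  exact: (truncated_bounds m0 hr0 hrp hp2 hq ow h).
have {hA} [A /all_and3[mA PA hA]] := choice hA.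
pose Z := \bigcup_N \bigcap_M A (N + M)%N.
have PZ : (P Z <= (3 * expR (- (tiny * m%:R)))%:E)%E by exact: liminf_measure_le.
have mZ : measurable Z.
  by apply: bigcupT_measurable => N; apply: bigcapT_measurable.
pose D := [set w | S_defined p Y w].
have mD : measurable D by exact: (measurable_S_defined iidY).
have PD : P (~` D) = 0.
  have := S_defined_ae m0 iidY p0 hp2; rewrite /almost_everywhere => /negligibleP; apply.
  exact: measurableC.
have sub : ~` good `<=` ~` D `|` Z.
  move=> w; rewrite goodE /= => ng.
  have [Dw|] := pselect (S_defined p Y w); [right|by left].
  apply: contrapT => nZ; apply: ng; split => // x xk.
  (* Infinitely many truncations satisfy the bounds, so the limit does. *)
  have often N : exists2 N', (N <= N')%N & ~ A N' w.
    apply: contrapT => h; apply: nZ; exists N => // M _; apply: contrapT => nA.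
    by apply: h; exists (N + M)%N; rewrite ?leq_addr.
  have conv : (fun N => (m%:R `^ q^-1)^-1 * lnorm r (S_part Y p (m + N) w x)) @ \oo -->
      (m%:R `^ q^-1)^-1 * lnorm r (S_op p Y w x).
    apply: cvgMr.
    exact: (cvg_comp _ _ (cvg_addnl m) (lnorm_S_part_cvg hr0 Dw (x := x))).
  apply/andP; split; rewrite leNgt; apply/negP => bad.
    have [N0 _ hN0] := cvgr_lt _ conv _ bad.
    have [N N0N /hA/(_ x xk)/andP[h _]] := often N0.
    by have := hN0 N N0N; rewrite /= ltNge h.
  have [N0 _ hN0] := cvgr_gt _ conv _ bad.
  have [N N0N /hA/(_ x xk)/andP[_ h]] := often N0.
  by have := hN0 N N0N; rewrite /= ltNge h.
have Pbad : (P (~` good) <= (3 * expR (- (tiny * m%:R)))%:E)%E.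
  apply: le_trans (_ : P (~` D `|` Z) <= _)%E.
    by apply: le_measure; rewrite ?inE//; [exact: measurableC|apply: measurableU => //; exact: measurableC].
  apply: le_trans (measureU2 _ _ _) _ => //; first exact: measurableC.
  have PD0 : (P (~` D) <= 0)%E by rewrite PD.
  by apply: le_trans (leeD PD0 PZ) _; rewrite add0e.
have -> : tiny / 4 * eta * n%:R = tiny / 4 * m%:R by rewrite -em mulrA.
(* If [expR (- b m) > 1 / 2] the claimed lower bound is negative; otherwise the
   rate [tiny = 4 b] absorbs the factor 3. *)
have [big|small] := ltrP (1 / 2 : R) (expR (- (tiny / 4 * m%:R))).
  by apply: lt_le_trans (measure_ge0 P good); rewrite lte_fin; lra.
have -> : P good = (1 - P (~` good))%E by rewrite -probability_setC ?setCK//; exact: measurableC.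
set a := expR _ in small *.
have a0 : 0 < a by exact: expR_gt0.
have a4 : expR (- (tiny * m%:R)) = a ^+ 4.
  by rewrite /a -expRM_natl; congr expR; field.
apply: (@lt_le_trans _ _ (1 - (3 * a ^+ 4)%:E)%E); last first.
  by apply: leeB => //; rewrite -a4.
rewrite -EFinB lte_fin ltrD2l ltrN2.
have a2 : a ^+ 2 <= a / 2 by nra.
have -> : a ^+ 4 = a ^+ 2 * a ^+ 2 by rewrite -exprD.
have a20 : 0 <= a ^+ 2 by exact: sqr_ge0.
have : a ^+ 2 * a ^+ 2 <= a / 2 * (1 / 2) by apply: ler_pM => //; lra.
lra.
Qed.
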